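(* Let $k\ge 4$ and let $G=(V,E)$ be the $1$-skeleton of a triangulation of the $(k-2)$-sphere such that $G$ is $(k-1)$-colorable. For any $k$-colorings $\alpha,\beta$ of $G$ that are each single-equivalent to some $k$-coloring using at most $k-1$ colors, there is a sequence of single-changes of length $O(\#V^{2\lfloor (k-1)/2\rfloor})$ transforming $\alpha$ into $\beta$.
   Context: A $k$-coloring is a map $V\to\{0,\dots,k-1\}$ giving adjacent vertices distinct colors. A single-change recolors exactly one vertex so that the result is again a proper coloring; two colorings are single-equivalent if one is obtained from the other by a sequence of single-changes. *)

(* Defs.v *)
From HB Require Import structures.
From mathcomp Require Import all_boot all_order all_algebra.
From mathcomp Require Import all_classical all_reals all_analysis.
Import Order.TTheory GRing.Theory Num.Theory.
Import numFieldNormedType.Exports.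

Set Implicit Arguments.
Unset Strict Implicit.
Unset Printing Implicit Defensive.

Local Open Scope ring_scope.

Definition homeomorphic (X Y : topologicalType) : Prop :=
  exists (f : X -> Y) (g : Y -> X),
    [/\ continuous f, continuous g, cancel f g & cancel g f].

(* Every element of V is required to be a vertex of K, and the empty simplex
   is excluded. *)
Definition simplicial_complex (V : finType) (K : {set {set V}}) : Prop :=
  [/\ finset.set0 \notin K,
      forall v : V, [set v]%SET \in K
    & forall s t : {set V},
        s \in K -> t \subset s -> t != finset.set0 -> t \in K].

(* The geometric realization in barycentric coordinates; used as a type below,
   it carries the subspace topology inherited from the product topology. *)
Definition realization (R : realType) (V : finType) (K : {set {set V}}) :
    set {ptws V -> R} :=
  [set x : {ptws V -> R} |
    [/\ forall v, 0 <= x v, \sum_(v : V) x v = 1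
      & finset (fun v => x v != 0) \in K]]%classic.
Arguments realization R {V} K.

(* The n-sphere lies in a space of dimension n + 1.  The norm of 'rV is the
   sup norm, so the Euclidean one is written out; the topology is the same. *)
Definition sphere (R : realType) (n : nat) : set 'rV[R]_n.+1 :=
  [set x : 'rV[R]_n.+1 | \sum_(i < n.+1) x ord0 i ^+ 2 = 1]%classic.
Arguments sphere R n : clear implicits.

Definition sphere_triangulation (R : realType) (n : nat) (V : finType)
    (K : {set {set V}}) : Prop :=
  simplicial_complex K /\
  homeomorphic (set_type (realization R K)) (set_type (sphere R n)).

Definition one_skeleton (V : finType) (K : {set {set V}}) : rel V :=
  fun u v => (u != v) && ([set u; v]%SET \in K).

Section Coloring.
Variables (V : finType) (e : rel V) (k : nat).

Definition coloring (c : {ffun V -> 'I_k}) : bool :=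
  [forall u, forall v, e u v ==> (c u != c v)].

Definition colorable : Prop := exists c : {ffun V -> 'I_k}, coloring c.

Definition num_colors (c : {ffun V -> 'I_k}) : nat :=
  #|finset (fun i => [exists v, c v == i])|.

Definition single_change : rel {ffun V -> 'I_k} := fun c d =>
  [&& coloring c, coloring d & #|finset (fun v => c v != d v)| == 1%N].

Definition single_equivalent : rel {ffun V -> 'I_k} := connect single_change.

End Coloring.

Arguments single_change {V} e {k}.
Arguments single_equivalent {V} e {k}.

(* Main.v *)
Require Import Defs.
From HB Require Import structures.
From mathcomp Require Import all_boot all_order all_algebra.
From mathcomp Require Import all_fingroup.
From mathcomp Require Import all_classical all_reals all_analysis.
From mathcomp Require Import zify ring lra.

(* Let n = k - 2 and let f be the (k - 1)-coloring, so that f is a bijection on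
   each facet.  A k-coloring alpha sends each facet to a permutation of the k
   colors, and crossing a ridge opposite to color i either fixes it or composes
   it with the transposition of i and the missing color.  If alpha is equivalent
   to a coloring with k - 1 colors, this map lifts to the Cayley tree of the free
   product of k - 1 groups of order 2: the lift is constant for a coloring with
   k - 1 colors, and a single change at v moves the whole star of v across one
   edge of the tree.  Conversely a node of maximal depth can be emptied, one
   vertex at a time.  A tree edge of type i on the way to the root is paid for by
   a vertex of color i, so the depth is at most #V and every vertex changes at
   most #V times.  This gives O(#V^2) changes, and no bound on the number of facets is needed.

   The only topological input is that the sphere and the stars of its vertices
   are strongly connected.  It follows from two facts on S^n: a set of dimension
   less than n has empty interior, and a set of dimension less than n - 1 does
   not separate locally.  For the latter, if the link of a face splits in two
   parts containing directions a and b, push the identity of a small cube to a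
   map avoiding a on one side and b on the other; on the face both are joined by
   a homotopy avoiding a generic point, because a Lipschitz image of a set of low
   dimension misses some point.  The result is a zero-free map close to the
   identity on the boundary, against the Poincare-Miranda theorem. *)

Set Implicit Arguments.
Unset Strict Implicit.
Unset Printing Implicit Defensive.

(** * Colorings of a strongly connected balanced complex *)

Section Words.
Variable m : nat.
Implicit Types (i j : 'I_m) (w q : seq 'I_m) (pi : {perm 'I_m.+1}).

(** Left multiplication by the generator [i] on normal forms in a free product of [m] groups of
    order 2, that is, a walk along the tree edge of type [i]. *)
Definition step i w := if w is j :: w' then if j == i then w' else i :: w else [:: i].

Definition reduced w := sorted (fun i j => i != j) w.

Lemma reduced_step i w : reduced w -> reduced (step i w).
Proof.
case: w => [|j w] //= jw; case: eqVneq => [_|ji]; first exact: path_sorted jw.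
by rewrite /= eq_sym ji.
Qed.

Lemma stepK i w : reduced w -> step i (step i w) = w.
Proof.
case: w => [|j w] /=; first by rewrite eqxx.
case: eqVneq => [<-|ji] /=; last by rewrite eqxx.
by case: w => [|l w] //= /andP[jl _]; rewrite eq_sym (negPf jl).
Qed.

Definition star i : {perm 'I_m.+1} := tperm (lift ord_max i) ord_max.

Definition act pi w : {perm 'I_m.+1} := foldr (fun i p => (star i * p)%g) pi w.

Lemma act_step pi i w : act pi (step i w) = (star i * act pi w)%g.
Proof.
case: w => [|j w] //=; case: eqVneq => // ->.
by rewrite mulgA tperm2 mul1g.
Qed.

(** The suffixes of a word are the nodes between it and the root, so a walk leaves the subtree above
    [q] only from [q] itself. *)
Lemma suffix_step i q w : suffix q w -> suffix q (step i w) \/ w = q.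
Proof.
case/suffixP => -[|j x] -> /=; first by right.
left; case: eqVneq => _; first exact: suffix_suffix.
by rewrite -!cat_cons suffix_suffix.
Qed.

(** The only exit from the subtree above [j :: q] is the edge of type [j] below it. *)
Lemma suffix_step_head i j q w : i != j -> suffix (j :: q) w -> suffix (j :: q) (step i w).
Proof.
move=> ij /(suffix_step i)[//|->] /=; rewrite eq_sym (negPf ij).
exact: (suffix_suffix [:: i] (j :: q)).
Qed.

Lemma step_rcons i w l : step i (rcons w l) != [::] -> step i (rcons w l) = rcons (step i w) l.
Proof. by case: w => [|j w] /=; [case: ifP; rewrite ?eqxx|case: ifP]. Qed.

End Words.

(** * Paths of bounded length *)

Section Reach.
Variables (T : Type) (e : rel T).

Definition reach (N : nat) (x y : T) := exists s, [/\ path e x s, last x s = y & size s <= N].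

Lemma reach_refl N x : reach N x x.
Proof. by exists [::]. Qed.

Lemma reach1 x y : e x y -> reach 1 x y.
Proof. by move=> xy; exists [:: y]; rewrite /= xy. Qed.

Lemma reach_trans N M x y z : reach N x y -> reach M y z -> reach (N + M) x z.
Proof.
move=> [s [xs <- sN]] [t [yt <- tM]]; exists (s ++ t).
by rewrite cat_path xs yt last_cat size_cat leq_add.
Qed.

Lemma reach_le N M x y : N <= M -> reach N x y -> reach M x y.
Proof. by move=> NM [s [? ? sN]]; exists s; split=> //; exact: leq_trans NM. Qed.

Lemma reach_sym N x y : symmetric e -> reach N x y -> reach N y x.
Proof.
move=> eC [s [xs <- sN]]; exists (rev (belast x s)).
split; last by rewrite size_rev size_belast.
  by rewrite rev_path (eq_path (e' := e)) // => a b; rewrite /= eC.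
by case: s {xs sN} => //= z t; rewrite rev_cons last_rcons.
Qed.

End Reach.

(** * Recoloring through mixtures of two colorings *)

Section Recoloring.
Variables (V : finType) (e : rel V) (k : nat).

Lemma single_changeC : symmetric (@single_change V e k).
Proof.
move=> c d; rewrite /single_change andbCA; congr [&& _, _ & _ == _].
by apply: eq_card => v; rewrite !inE eq_sym.
Qed.

Lemma coloringP (c : {ffun V -> 'I_k}) :
  reflect (forall u v, e u v -> c u != c v) (coloring e c).
Proof.
apply: (iffP forallP) => h u; first by move=> v; have /forallP/(_ v)/implyP := h u.
by apply/forallP => v; apply/implyP; exact: h.
Qed.

(** Every vertexwise mixture of [c] and [d] is proper, so the vertices where they differ can be
    recolored one at a time in any order. *)
Lemma reach_mix (c d : {ffun V -> 'I_k}) : coloring e c -> coloring e d ->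
  (forall u v, e u v -> c u != d v /\ d u != c v) ->
  reach (single_change e) #|[set v | c v != d v]%SET| c d.
Proof.
move: {2}#|_| (erefl #|[set v | c v != d v]%SET|) => N.
elim: N c => [|N IH] c cN cc dc cd.
  rewrite cN; suff -> : c = d by exact: reach_refl.
  apply/ffunP => v; apply/eqP; apply/negPn/negP => cv.
  by have := card0_eq cN v; rewrite !inE cv.
have /set0Pn[v vD] : [set v | c v != d v]%SET != finset.set0 by rewrite -card_gt0 cN.
rewrite inE in vD.
pose c' := [ffun u => if u == v then d v else c u].
have diff : [set u | c' u != d u]%SET = [set u | c u != d u]%SET :\ v.
  by apply/setP => u; rewrite !inE ffunE; case: (eqVneq u v) => [->|] //=; rewrite eqxx.
have c'N : #|[set u | c' u != d u]%SET| = N.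
  by apply/eqP; rewrite -eqSS -cN diff (cardsD1 v [set u | c u != d u]%SET) inE vD.
have c'c : coloring e c'.
  apply/coloringP => u w uw; rewrite !ffunE; have [cdu cdw] := cd u w uw.
  case: (eqVneq u v) => [uv|_]; case: (eqVneq w v) => [wv|_] //.
  - by move: uw; rewrite uv wv => vv; have := (coloringP _ dc) v v vv.
  - by rewrite -uv.
  - by rewrite -wv.
  - exact: (coloringP _ cc).
have c'd u w : e u w -> c' u != d w /\ d u != c' w.
  move=> uw; rewrite !ffunE; have [cdu cdw] := cd u w uw.
  by split; [case: (eqVneq u v) => [<-|]|case: (eqVneq w v) => [<-|]] => //; move/coloringP: dc; apply.
rewrite cN -add1n -{1}c'N; apply: reach_trans (IH c' c'N c'c dc c'd).
apply: reach1; rewrite /single_change cc c'c /=; apply/eqP.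
rewrite (_ : [set _ | _]%SET = [set v]%SET) ?cards1 //.
apply/setP => u; rewrite !inE ffunE; case: (eqVneq u v) => [->|_]; first exact: vD.
by rewrite eqxx.
Qed.

End Recoloring.

Lemma leq_sub_succ a b d : a - b <= d.+1 -> a - (1 + b) <= d.
Proof. lia. Qed.

(** * Facets, ridges and strong connectivity of a pure balanced complex *)

Definition link_rel (V : finType) (K : {set {set V}}) (s : {set V}) : rel V := fun u w =>
  [&& u \notin s, w \notin s & (u |: (w |: s))%SET \in K].

Section BalancedComplex.
Variables (V : finType) (K : {set {set V}}) (m : nat) (f : {ffun V -> 'I_m}).
Local Notation G := (one_skeleton K).
Hypothesis K_vertex : forall v, [set v]%SET \in K.
Hypothesis K_sub : forall s t : {set V}, s \in K -> t \subset s -> t != finset.set0 -> t \in K.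
Hypothesis f_col : coloring G f.
Hypothesis K_pure : forall s, s \in K -> #|s| < m -> exists2 v, v \notin s & (v |: s)%SET \in K.

(** The link of the empty face is the whole complex. The bound on [#|s|] says that the link has
    dimension at least 1. *)
Hypothesis K_link : forall s u w, (s == finset.set0) || (s \in K) -> #|s|.+1 < m ->
  u \notin s -> w \notin s -> (u |: s)%SET \in K -> (w |: s)%SET \in K ->
  connect (link_rel K s) u w.

Definition facet (F : {set V}) := (F \in K) && (#|F| == m).

Lemma facetK F : facet F -> F \in K. Proof. by case/andP. Qed.

Lemma face_edge s u v : s \in K -> u \in s -> v \in s -> u != v -> G u v.
Proof.
move=> sK us vs uv; rewrite /one_skeleton uv (K_sub sK) //.
  by apply/fintype.subsetP => w; rewrite !inE => /orP[] /eqP->.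
by apply/set0Pn; exists u; rewrite !inE eqxx.
Qed.

Lemma coloring_inj (k : nat) (c : {ffun V -> 'I_k}) s u v :
  coloring G c -> s \in K -> u \in s -> v \in s -> c u = c v -> u = v.
Proof.
move=> cc sK us vs cuv; apply/eqP; apply/negPn/negP => uv.
by have := elimT (coloringP _ _) cc u v (face_edge sK us vs uv); rewrite cuv eqxx.
Qed.

Lemma card_facet_image k (c : {ffun V -> 'I_k}) F :
  coloring G c -> facet F -> #|c @: F| = m.
Proof.
move=> cc /andP[FK /eqP <-]; apply: card_in_imset => u v; exact: coloring_inj cc FK.
Qed.

Lemma facet_color F i : facet F -> exists2 v, v \in F & f v = i.
Proof.
move=> FF; have : i \in f @: F.
  suff -> : (f @: F = [set: 'I_m])%SET by rewrite inE.
  by apply/eqP; rewrite finset.eqEcard finset.subsetT (card_facet_image f_col FF) cardsT card_ord leqnn.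
by case/imsetP => v vF ->; exists v.
Qed.

Lemma face_in_facet s : s \in K -> exists2 F, facet F & s \subset F.
Proof.
move: {2}(m - #|s|) (leqnn (m - #|s|)) => d; elim: d s => [|d IH] s sd sK.
  exists s => //; rewrite /facet sK eqn_leq /=; apply/andP; split; last by rewrite -subn_eq0 -leqn0.
  suff <- : #|f @: s| = #|s| by rewrite -[leqRHS]card_ord max_card.
  by apply: card_in_imset => u v; exact: coloring_inj f_col sK.
have [sm|sm] := ltnP #|s| m; last first.
  by apply: IH => //; move: sm; rewrite -subn_eq0 => /eqP ->.
have [v vs vsK] := K_pure sK sm.
have [||F FF vsF] := IH (v |: s)%SET => //; first by rewrite cardsU1 vs leq_sub_succ.
by exists F => //; apply: fintype.subset_trans vsF; exact: finset.subsetUr.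
Qed.

Definition ridge_adj (s : {set V}) : rel {set V} := fun F F' =>
  [&& facet F, facet F', s \subset F, s \subset F' & m <= #|(F :&: F')%SET|.+1].

Lemma ridge_adj_sub (s t : {set V}) F F' : s \subset t -> connect (ridge_adj t) F F' ->
  connect (ridge_adj s) F F'.
Proof.
move=> st; apply: connect_sub => {}F {}F' /and5P[? ? tF tF' ?]; apply: connect1.
by apply/and5P; split=> //; exact: fintype.subset_trans st _.
Qed.

(** Induction on the codimension of [s]: a path in the link of [s] yields facets whose successive
    members share [s] and one more vertex, and these are joined inside the smaller star. *)
Lemma strongly_connected s F F' : (s == finset.set0) || (s \in K) ->
  facet F -> facet F' -> s \subset F -> s \subset F' -> connect (ridge_adj s) F F'.
Proof.
move: {2}(m - #|s|) (leqnn (m - #|s|)) => d.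
elim: d s F F' => [|d IH] s F F' sd sK FF FF' sF sF'.
  apply: connect1; apply/and5P; split=> //.
  suff sI : #|s| <= #|(F :&: F')%SET|.
    by rewrite (leq_trans _ (leqW sI)) // -subn_eq0 -leqn0.
  by apply: subset_leq_card; rewrite finset.subsetI sF.
have [sm|sm] := leqP m #|s|.+1.
  apply: connect1; apply/and5P; split=> //; apply: (leq_trans sm); rewrite ltnS.
  by apply: subset_leq_card; rewrite finset.subsetI sF.
have extra F0 : facet F0 -> s \subset F0 -> exists2 u, u \in F0 & u \notin s.
  move=> /andP[_ /eqP F0m] sF0; apply/subsetPn; apply/negP => F0s.
  have := subset_leq_card F0s; rewrite F0m => ms.
  by have := leq_ltn_trans ms (ltnW sm); rewrite ltnn.
have grow u F0 : facet F0 -> s \subset F0 -> u \in F0 -> (u |: s)%SET \in K.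
  move=> F0F sF0 uF0; apply: K_sub (facetK F0F) _ _; first by rewrite finset.subUset finset.sub1set uF0.
  by apply/set0Pn; exists u; rewrite !inE eqxx.
have [u uF us] := extra F FF sF; have [w wF' ws] := extra F' FF' sF'.
have /connectP[p up wE] := K_link sK sm us ws (grow u F FF sF uF) (grow w F' FF' sF' wF').
elim: p u F FF sF us uF up wE => [|u1 p IHp] u F FF sF us uF /=.
  move=> _ uw; apply: (@ridge_adj_sub _ (w |: s)); first exact: finset.subsetUr.
  apply: IH => //; rewrite ?finset.subUset ?finset.sub1set ?sF ?sF' ?wF' ?uw ?uF //.
  - by rewrite cardsU1 us leq_sub_succ.
  - by rewrite (grow u F) ?orbT.
case/andP => /and3P[_ u1s uuK] u1p wE.
have [F1 FF1 /fintype.subsetP uF1] := face_in_facet uuK.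
have sF1 : s \subset F1 by apply/fintype.subsetP => v vs; apply: uF1; rewrite !inE vs !orbT.
apply: (connect_trans (y := F1)).
  apply: (@ridge_adj_sub _ (u |: s)); first exact: finset.subsetUr.
  apply: IH => //; rewrite ?finset.subUset ?finset.sub1set ?sF ?sF1 ?uF //.
  - by rewrite cardsU1 us leq_sub_succ.
  - by rewrite (grow u F) ?orbT.
  - by rewrite uF1 // !inE eqxx.
by apply: (IHp u1) => //; apply: uF1; rewrite !inE eqxx orbT.
Qed.

Definition ridge_nbr (u : V) (F F' : {set V}) := [&& u \in F, u \notin F' & F :\ u \subset F'].

Lemma ridge_adjP s F F' : ridge_adj s F F' ->
  [/\ facet F, facet F', s \subset F' & F = F' \/ exists2 u, u \notin s & ridge_nbr u F F'].
Proof.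
case/and5P => FF FF' sF sF' FF'm; split=> //.
have [FsF'|/subsetPn[u uF uF']] := boolP (F \subset F').
  left; apply/eqP; rewrite finset.eqEcard FsF'.
  by move: FF FF' => /andP[_ /eqP->] /andP[_ /eqP->]; rewrite leqnn.
right; exists u; first by apply: contra uF'; exact: (fintype.subsetP sF').
rewrite /ridge_nbr uF uF' /=; suff -> : F :\ u = F :&: F' by exact: finset.subsetIr.
apply/esym/eqP; rewrite finset.eqEcard; apply/andP; split.
  apply/fintype.subsetP => v; rewrite !inE => /andP[vF vF']; rewrite vF andbT.
  by apply: contraNneq uF' => <-.
by move: FF => /andP[_ /eqP Fm]; move: (cardsD1 u F); rewrite uF Fm => Em; rewrite Em in FF'm.
Qed.

(** Propagation along ridge paths inside the star of [s]. The vertex [u] left behind is never in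
    [s], which later restricts the types of the tree edges crossed. *)
Lemma facet_induction (s : {set V}) (P : {set V} -> Prop) F0 :
  (s == finset.set0) || (s \in K) -> facet F0 -> s \subset F0 -> P F0 ->
  (forall F F' u, facet F -> facet F' -> s \subset F -> s \subset F' -> u \notin s ->
    ridge_nbr u F F' -> P F -> P F') ->
  forall F, facet F -> s \subset F -> P F.
Proof.
move=> sK FF0 sF0 P0 Pstep F FF sF.
have /connectP[p] := strongly_connected sK FF0 FF sF0 sF.
elim: p F0 FF0 sF0 P0 => [|F1 p IHp] F0 FF0 sF0 P0 /=; first by move=> _ ->.
case/andP => /ridge_adjP[_ FF1 sF1 [<-|[u us F01]]]; first exact: IHp.
by apply: IHp => //; exact: Pstep F01 P0.
Qed.

(** [f] takes every color exactly once on a facet, so the two vertices opposite to a common ridge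
    have the same color. *)
Lemma ridge_nbr_other u v F F' : facet F -> facet F' -> ridge_nbr u F F' ->
  v \in F' -> v \notin F -> f v = f u.
Proof.
move=> FF FF' /and3P[uF uF' /fintype.subsetP FuF'] vF' vF.
have [w wF fw] := facet_color (f v) FF; rewrite -fw.
have [->//|wu] := eqVneq w u.
have wF' : w \in F' by apply: FuF'; rewrite !inE wu.
by move: vF; rewrite -(coloring_inj f_col (facetK FF') wF' vF' fw) wF.
Qed.

(** * Lifting colorings to the Cayley tree *)

Implicit Types (pi : {perm 'I_m.+1}) (alpha : {ffun V -> 'I_m.+1}) (h : {set V} -> seq 'I_m).

(* [h F] is the node, in the Cayley tree of a free product of groups of order 2,
   to which the facet [F] is sent; [act] projects that tree to the permutations
   of the colors generated by the transpositions [star i]. *)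
Definition lifted pi alpha h :=
  [/\ forall F, facet F -> reduced (h F),
      forall F v, facet F -> v \in F -> alpha v = act pi (h F) (lift ord_max (f v)) &
      forall F F' u, facet F -> facet F' -> ridge_nbr u F F' ->
        h F' = h F \/ h F' = step (f u) (h F)].

(** The permutation [act pi (h F)] carries the values [lift ord_max i] to the colors on [F], which
    leaves [ord_max] for the absent one. *)
Lemma missing_color pi alpha h F c : lifted pi alpha h -> facet F ->
  (forall v, v \in F -> alpha v != c) -> act pi (h F) ord_max = c.
Proof.
case=> _ alphaE _ FF Fc; rewrite -[c](permKV (act pi (h F))); congr (act _ _ _).
case: (unliftP ord_max ((act pi (h F))^-1%g c)) => [i ci|-> //].
have [v vF fv] := facet_color i FF.
by have := Fc v vF; rewrite (alphaE F v FF vF) fv -ci permKV eqxx.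
Qed.

(** If the color [c] is absent everywhere, each facet carries all the others, and the color of the
    new vertex is forced across every ridge. Hence [alpha] factors through [f], and the constant
    lift works. *)
Lemma lift_few_colors alpha : (exists F, facet F) -> coloring G alpha ->
  num_colors alpha <= m -> exists pi, lifted pi alpha (fun=> [::]).
Proof.
move=> [F0 FF0] ac few.
have [c cP] : exists c, forall v, alpha v != c.
  have : [set i | [exists v, alpha v == i]]%SET != [set: 'I_m.+1]%SET.
    by apply: contraTneq few; rewrite /num_colors => ->; rewrite cardsT card_ord ltnn.
  rewrite -finset.subTset => /subsetPn[c _]; rewrite inE negb_exists => /forallP cP.
  by exists c.
have all_others F i : facet F -> i != c -> exists2 v, v \in F & alpha v = i.
  move=> FF ic; suff /imsetP[v vF ->] : i \in alpha @: F by exists v.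
  suff -> : (alpha @: F = [set~ c])%SET by rewrite !inE.
  apply/eqP; rewrite finset.eqEcard (card_facet_image ac FF) cardsC1 card_ord leqnn andbT.
  by apply/fintype.subsetP => _ /imsetP[v _ ->]; rewrite !inE cP.
have same F : facet F -> forall v w, v \in F -> w \in F0 -> f v = f w -> alpha v = alpha w.
  move=> FF; apply: (@facet_induction finset.set0 (fun F => forall v w, v \in F -> w \in F0 ->
    f v = f w -> alpha v = alpha w) F0) => //; rewrite ?eqxx ?finset.sub0set //.
    by move=> v w vF wF fvw; rewrite (coloring_inj f_col (facetK FF0) vF wF fvw).
  move=> {FF}F F' u FF FF' _ _ _ FuF' IH v w vF' wF0 fvw.
  have [vF|vF] := boolP (v \in F); first exact: IH.
  have fvu := ridge_nbr_other FF FF' FuF' vF' vF.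
  have /and3P[uF _ /fintype.subsetP sub] := FuF'.
  have [z zF zv] := all_others F (alpha v) FF (cP v).
  have [zu|zu] := eqVneq z u; first by rewrite -zv zu; apply: IH => //; rewrite -fvu.
  have zF' : z \in F' by apply: sub; rewrite !inE zu.
  by move: vF; rewrite -(coloring_inj ac (facetK FF') zF' vF' zv) zF.
have [vert vertP] : exists vert : 'I_m -> V, forall i, vert i \in F0 /\ f (vert i) = i.
  have P i : exists v, v \in F0 /\ f v = i by have [v ? ?] := facet_color i FF0; exists v.
  by exists (fun i => projT1 (cid (P i))) => i; case: cid.
pose p (x : 'I_m.+1) := if unlift ord_max x is Some i then alpha (vert i) else c.
have p_inj : injective p.
  move=> x y; rewrite /p; case: unliftP => [i ->|->]; case: unliftP => [j ->|->] //.
  - move=> ij; have [iF fi] := vertP i; have [jF fj] := vertP j.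
    by rewrite -fi (coloring_inj ac (facetK FF0) iF jF ij) fj.
  - by move=> E; have := cP (vert i); rewrite E eqxx.
  - by move=> E; have := cP (vert j); rewrite -E eqxx.
exists (perm p_inj); split=> // [F v FF vF|]; last by left.
rewrite permE /p liftK; have [iF fi] := vertP (f v).
exact: (same F).
Qed.

Lemma vertex_in_facet v : exists2 F, facet F & v \in F.
Proof. by have [F FF] := face_in_facet (K_vertex v); rewrite finset.sub1set; exists F. Qed.

(** Crossing a tree edge composes with a transposition moving [ord_max], so it changes the missing
    color. *)
Lemma ridge_nbr_step pi alpha h F F' u : lifted pi alpha h -> facet F -> facet F' ->
  ridge_nbr u F F' -> act pi (h F) ord_max = act pi (h F') ord_max -> h F' = h F.
Proof.
move=> [_ _ hstep] FF FF' FuF' E; have [//|h'] := hstep _ _ _ FF FF' FuF'.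
move: E; rewrite h' act_step permM tpermR => /perm_inj /eqP.
by rewrite (negPf (neq_lift _ _)).
Qed.

(** Effect on the lift of recoloring [v]: its whole star crosses the tree edge of type [f v]. *)
Definition shift_lift (v : V) h (F : {set V}) := if v \in F then step (f v) (h F) else h F.

Lemma lifted_shift pi alpha h v c : lifted pi alpha h ->
  (forall F, facet F -> v \in F -> act pi (h F) ord_max = c) ->
  lifted pi [ffun u => if u == v then c else alpha u] (shift_lift v h).
Proof.
move=> hl star_c; have [hred hE hstep] := hl; rewrite /shift_lift; split.
- by move=> F FF; case: ifP => _; [apply: reduced_step|]; exact: hred.
- move=> F u FF uF; rewrite ffunE; case: (eqVneq u v) => [uv|uv].
    by rewrite -uv uF act_step permM tpermL star_c // -uv.
  case: ifP => vF; last exact: hE.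
  rewrite act_step permM tpermD ?neq_lift //; first exact: hE.
  rewrite (inj_eq (@lift_inj _ _)); apply: contra uv => /eqP fvu.
  by rewrite (coloring_inj f_col (facetK FF) uF vF).
- move=> F F' u FF FF' FuF'; have /and3P[uF uF' /fintype.subsetP sub] := FuF'.
  have [vF|vF] := boolP (v \in F); have [vF'|vF'] := boolP (v \in F').
  + left; congr step; apply: (ridge_nbr_step hl FF FF' FuF').
    exact: etrans (star_c _ FF vF) (esym (star_c _ FF' vF')).
  (* Here only one of the two facets is shifted, which exchanges the two alternatives in the ridge
     condition of [lifted]. *)
  + have -> : v = u.
      by apply/eqP; apply: contraNT vF' => vu; apply: sub; rewrite !inE vu.
    have [->|->] := hstep _ _ _ FF FF' FuF'; last by left.
    by right; rewrite stepK //; exact: hred.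
  + have fvu := ridge_nbr_other FF FF' FuF' vF' vF.
    rewrite fvu; have [->|->] := hstep _ _ _ FF FF' FuF'; first by right.
    by left; rewrite stepK //; exact: hred.
  + exact: hstep.
Qed.

(** The new color of [v] is absent under [alpha] from every facet of the star of [v], so these
    facets share their missing color and the shift applies. *)
Lemma lifted_single_change pi alpha beta h : lifted pi alpha h ->
  single_change G alpha beta -> exists h', lifted pi beta h'.
Proof.
move=> hl /and3P[ac bc /cards1P[v vP]].
have betaE : beta = [ffun u => if u == v then beta v else alpha u].
  apply/ffunP => u; rewrite ffunE; case: (eqVneq u v) => [-> //|uv].
  apply/eqP; rewrite eq_sym; apply/negPn/negP => d.
  have : u \in [set w | alpha w != beta w]%SET by rewrite inE.
  by rewrite vP inE (negPf uv).
exists (shift_lift v h); rewrite betaE; apply: lifted_shift => // F FF vF.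
apply: (missing_color hl FF) => w wF; have [->|wv] := eqVneq w v.
  have : v \in [set w | alpha w != beta w]%SET by rewrite vP inE.
  by rewrite inE.
have -> : alpha w = beta w by rewrite betaE ffunE (negPf wv).
by apply: contra wv => /eqP /(coloring_inj bc (facetK FF) wF vF) ->.
Qed.

Lemma lifted_equivalent pi alpha beta h : lifted pi alpha h ->
  single_equivalent G alpha beta -> exists h', lifted pi beta h'.
Proof.
move=> hl /connectP[p]; elim: p alpha h hl => [|a p IH] alpha h hl /=; first by move=> _ ->; exists h.
by move=> /andP[/(lifted_single_change hl)[h' hl'] ap]; exact: (IH _ _ hl' ap).
Qed.

Lemma single_equivalentC : symmetric (@single_equivalent V G m.+1).
Proof. by apply: sym_connect_sym; exact: single_changeC. Qed.

(** The last letter can change only on passing through the root, to which no facet is sent. *)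
Lemma lifted_last pi alpha h F0 l : lifted pi alpha h -> facet F0 ->
  (forall F, facet F -> h F != [::]) -> last l (h F0) = l ->
  forall F, facet F -> exists w, h F = rcons w l.
Proof.
move=> [_ _ hstep] FF0 hne hl F FF.
have lastl : forall F, facet F -> last l (h F) = l.
  move=> {FF}F FF; apply: (@facet_induction finset.set0 (fun F => last l (h F) = l) F0) => //;
    rewrite ?eqxx ?finset.sub0set //.
  move=> {FF}F F' u FF FF' _ _ _ /(hstep _ _ _ FF FF')[->//|E] lF.
  rewrite E; have := hne _ FF'; have := hne _ FF; rewrite E.
  move: lF; case: (h F) => [//|j w] /= lF _; case: (j =P f u) => _ /=; last by [].
  by case: w lF => [|x w]; rewrite ?eqxx.
have := lastl F FF; have := hne F FF; case/lastP: (h F) => // w x _.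
by rewrite last_rcons => ->; exists w.
Qed.

Lemma act_rcons pi w (l : 'I_m) : act pi (rcons w l) = act (star l * pi)%g w.
Proof. by rewrite /act foldr_rcons. Qed.

(** If the root is missed, all words end in the same letter [l]. Moving the root one edge towards
    the image deletes this letter and turns [pi] into [star l * pi]; the length of [h F0] bounds the
    number of moves. *)
Lemma lifted_rooted pi alpha h F0 : lifted pi alpha h -> facet F0 ->
  exists pi' h', lifted pi' alpha h' /\ exists2 F, facet F & h' F = [::].
Proof.
move: {2}(size _) (leqnn (size (h F0))) => d; elim: d pi h => [|d IH] pi h hd hl FF0.
  by exists pi, h; split=> //; exists F0 => //; apply: size0nil; apply/eqP; rewrite -leqn0.
have [[F [FF hF]]|none] := pselect (exists F, facet F /\ h F = [::]).
  by exists pi, h; split=> //; exists F.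
have hne F : facet F -> h F != [::] by move=> FF; apply/eqP => hF; apply: none; exists F.
have [l lP] : exists l, last l (h F0) = l.
  by have := hne _ FF0; case: (h F0) => // j w _; exists (last j w).
have hr F : facet F -> exists w, h F = rcons w l by exact: lifted_last hl FF0 hne lP F.
pose h' F := take (size (h F)).-1 (h F).
have h'E F w : h F = rcons w l -> h' F = w.
  by move=> hF; rewrite /h' hF size_rcons -cats1 take_size_cat.
have [hred hE hstep] := hl; apply: (IH (star l * pi)%g h') => //.
  by have [w hw] := hr _ FF0; rewrite (h'E _ _ hw); move: hd; rewrite hw size_rcons.
split.
- move=> F FF; have [w hw] := hr _ FF; rewrite (h'E _ _ hw); have := hred _ FF.
  by rewrite hw; case: (w) => //= x w'; rewrite /reduced /= rcons_path => /andP[].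
- move=> F v FF vF; have [w hw] := hr _ FF.
  by rewrite (h'E _ _ hw) -act_rcons -hw; exact: hE.
- move=> F F' u FF FF' FuF'; have [w hw] := hr _ FF; have [w' hw'] := hr _ FF'.
  rewrite (h'E _ _ hw) (h'E _ _ hw').
  have := hstep _ _ _ FF FF' FuF'; rewrite hw hw' => -[/rcons_inj[->]|E]; first by left.
  right; move: (E); rewrite step_rcons => [/rcons_inj[]//|].
  by rewrite -E; case: (w').
Qed.

(** The image of [h] is connected and contains the root, hence it contains the path from each of its
    nodes to the root. *)
Lemma suffix_in_image pi alpha h F0 F q : lifted pi alpha h -> facet F0 -> h F0 = [::] ->
  facet F -> suffix q (h F) -> exists2 F', facet F' & h F' = q.
Proof.
move=> [_ _ hstep] FF0 h0 FF qF; have [q0|q0] := eqVneq q [::].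
  by exists F0; rewrite ?h0 ?q0.
apply: contrapT => none.
have : suffix q (h F0).
  apply: (@facet_induction finset.set0 (fun F => suffix q (h F)) F) => //;
    rewrite ?eqxx ?finset.sub0set //.
  move=> F1 F2 u FF1 FF2 _ _ _ /(hstep _ _ _ FF1 FF2)[->//|->] /(suffix_step (f u))[//|E].
  by case: none; exists F1.
by rewrite h0 suffixs0 (negPf q0).
Qed.

(** Each edge between [h F] and the root is assigned a vertex whose color is the type of the edge.
    These vertices are distinct, because no tree edge of type [i] is crossed inside the star of a
    vertex of color [i]. *)
Lemma depth_le pi alpha h F0 F : lifted pi alpha h -> facet F0 -> h F0 = [::] ->
  facet F -> size (h F) <= #|V|.
Proof.
move=> hl FF0 h0 FF; have [_ _ hstep] := hl; set t := h F.
(* Position [p] stands for the edge from [drop p t] to [drop p.+1 t]. *)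
have crossing (p : 'I_(size t)) : exists vF : V * {set V},
    [/\ facet vF.2, vF.1 \in vF.2, h vF.2 = drop p t & f vF.1 :: drop p.+1 t = drop p t].
  have [F' FF' hF'] := suffix_in_image hl FF0 h0 FF (suffix_drop t p).
  case dt : (drop p t) hF' => [|i s] hF'.
    by have := size_drop p t; rewrite dt /=; have := ltn_ord p; lia.
  have [v vF' fv] := facet_color i FF'; exists (v, F'); split=> //=.
  by rewrite -addn1 addnC -drop_drop dt /= drop0 fv.
pose vF p := projT1 (cid (crossing p)).
have vFP p : [/\ facet (vF p).2, (vF p).1 \in (vF p).2, h (vF p).2 = drop p t &
    f (vF p).1 :: drop p.+1 t = drop p t] by rewrite /vF; case: cid.
(* A repeated vertex would allow a walk in its star from [drop p t] to the shorter word [drop p' t]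
   that avoids the only exit from the subtree above [drop p t]. *)
have v_neq (p p' : 'I_(size t)) : p < p' -> (vF p).1 <> (vF p').1.
  move=> pp' E; have [FFp up hp fp] := vFP p; have [FFp' up' hp' _] := vFP p'.
  have : suffix (drop p t) (h (vF p').2).
    apply: (@facet_induction [set (vF p).1] (fun F => suffix (drop p t) (h F)) (vF p).2) => //;
      rewrite ?K_vertex ?orbT ?finset.sub1set ?hp ?suffix_refl ?up // ?E //.
    move=> F1 F2 w FF1 FF2; rewrite !finset.sub1set => uF1 uF2.
    rewrite inE => wu Fw; have /and3P[wF1 _ _] := Fw.
    have [->//|->] := hstep _ _ _ FF1 FF2 Fw.
    rewrite -fp; apply: suffix_step_head; apply: contra wu => /eqP fwu.
    by rewrite E in fwu; rewrite (coloring_inj f_col (facetK FF1) wF1 uF1 fwu).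
  have lt : size t - p' < size t - p by apply: ltn_sub2l => //; exact: ltn_ord.
  by rewrite hp' => /size_suffix; rewrite !size_drop leqNgt lt.
have inj : injective (fun p => (vF p).1).
  move=> p p' E; apply/val_inj => /=.
  case: (ltngtP p p') => // [pp'|p'p]; first by case: (v_neq _ _ pp').
  by case: (v_neq _ _ p'p).
by have := leq_card _ inj; rewrite card_ord.
Qed.

(** * Recoloring by induction on the total depth *)

Definition depth h v := \max_(F : {set V} | facet F && (v \in F)) size (h F).

Definition base pi : {ffun V -> 'I_m.+1} := [ffun v => pi (lift ord_max (f v))].

Lemma lifted_coloring pi alpha h : lifted pi alpha h -> coloring G alpha.
Proof.
move=> [_ hE _]; apply/coloringP => u v /andP[uv uvK].
have [F FF /fintype.subsetP uvF] := face_in_facet uvK.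
have uF : u \in F by apply: uvF; rewrite !inE eqxx.
have vF : v \in F by apply: uvF; rewrite !inE eqxx orbT.
rewrite (hE F u) // (hE F v) // (inj_eq perm_inj) (inj_eq (@lift_inj _ _)).
by apply: contra uv => /eqP /(coloring_inj f_col (facetK FF) uF vF) ->.
Qed.

(** Take a facet of maximal depth and its vertex [v] whose color is the head letter. The star of [v]
    sits at a single node, and recoloring [v] moves it one edge towards the root. *)
Lemma reach_base pi alpha h : lifted pi alpha h ->
  reach (single_change G) (\sum_v depth h v) alpha (base pi).
Proof.
move: {2}(\sum_v _) (leqnn (\sum_v depth h v)) => d.
elim: d alpha h => [|d IH] alpha h hd hl.
  exists [::]; split=> //; apply/ffunP => v; have [_ hE _] := hl; rewrite ffunE.
  have [F FF vF] := vertex_in_facet v; rewrite (hE F v) //.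
  suff -> : h F = [::] by [].
  move: hd; rewrite leqn0 sum_nat_eq0 => /forall_inP/(_ v isT)/eqP d0.
  apply: size0nil; apply/eqP; rewrite -leqn0 -d0.
  by apply: (bigmax_sup F); rewrite ?FF.
have [zero|nonzero] := pselect (forall F, facet F -> h F = [::]).
  exists [::]; split=> //; apply/ffunP => v; have [_ hE _] := hl; rewrite ffunE.
  by have [F FF vF] := vertex_in_facet v; rewrite (hE F v) // zero.
have [F1 [FF1 hF1]] : exists F, facet F /\ h F != [::].
  apply: contrapT => none; apply: nonzero => F FF; apply/eqP; apply/negPn/negP => hF.
  by apply: none; exists F.
pose F := [arg max_(F > F1 | facet F) size (h F)].
have [FF Fmax] : facet F /\ forall F', facet F' -> size (h F') <= size (h F).
  by rewrite /F; case: arg_maxnP.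
have [hred hE hstep] := hl.
case hF : (h F) => [|i t].
  by have := Fmax _ FF1; rewrite hF leqn0 size_eq0 (negPf hF1).
have [v vF fv] := facet_color i FF.
(* Leaving the node inside the star would cross an edge of a type other than [i] and so lengthen the
   word, against maximality. *)
have star_t F' : facet F' -> v \in F' -> h F' = i :: t.
  move=> FF' vF'; apply: (@facet_induction [set v] (fun F => h F = i :: t) F) => //;
    rewrite ?K_vertex ?orbT ?finset.sub1set //.
  move=> {FF' vF'}F' F'' u FF' FF''; rewrite !finset.sub1set inE => vF' vF'' uv Fu E.
  have [->//|E'] := hstep _ _ _ FF' FF'' Fu.
  have /and3P[uF' _ _] := Fu; have := Fmax _ FF''.
  rewrite E' E hF /= -fv; case: eqP => [fvu|_] /=; last by rewrite ltnn.
  by move: uv; rewrite (coloring_inj f_col (facetK FF') vF' uF' fvu) eqxx.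
pose c := act pi (i :: t) ord_max.
have hl' : lifted pi [ffun u => if u == v then c else alpha u] (shift_lift v h).
  by apply: lifted_shift => // F' FF' vF'; rewrite (star_t F').
have h'v F' : facet F' -> v \in F' -> shift_lift v h F' = t.
  by move=> FF' vF'; rewrite /shift_lift vF' (star_t F') //= -fv eqxx.
have le_depth u : depth (shift_lift v h) u <= depth h u.
  apply/bigmax_leqP => F' /andP[FF' uF'].
  apply: leq_trans (leq_bigmax_cond (F := fun F => size (h F)) F' _); last by rewrite FF' uF'.
  have [vF'|vF'] := boolP (v \in F'); last by rewrite /shift_lift (negPf vF').
  by rewrite h'v // star_t //= leqnSn.
have lt_depth : depth (shift_lift v h) v < depth h v.
  apply: (@leq_trans (size t).+1); last first.
    by rewrite /depth (bigmax_sup F) // ?FF ?vF // hF.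
  by rewrite ltnS; apply/bigmax_leqP => F' /andP[FF' vF']; rewrite h'v.
have lt_sum : \sum_u depth (shift_lift v h) u < \sum_u depth h u.
  rewrite (bigD1 v) //= [X in _ < X](bigD1 v) //= -addSn leq_add //.
  by apply: leq_sum => u _; exact: le_depth.
apply: (reach_le lt_sum); rewrite -[(\sum_u _).+1]add1n.
apply: reach_trans (IH _ _ _ hl'); last by rewrite -ltnS (leq_trans lt_sum).
apply: reach1; rewrite /single_change (lifted_coloring hl) (lifted_coloring hl') /=.
apply/cards1P; exists v; apply/setP => u; rewrite !inE ffunE.
case: (eqVneq u v) => [->|_]; last by rewrite eqxx.
by rewrite (hE F v) // /c hF (inj_eq perm_inj) eq_sym neq_lift.
Qed.

Lemma base_coloring pi : coloring G (base pi).
Proof.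
apply/coloringP => u v uv; rewrite !ffunE (inj_eq perm_inj) (inj_eq (@lift_inj _ _)).
exact: (elimT (coloringP _ _) f_col).
Qed.

(** Only the vertices of [f]-color [i] change, and all of them take the color [pi ord_max], which is
    free in [base pi]. *)
Lemma reach_star pi i : reach (single_change G) #|V| (base pi) (base (star i * pi)%g).
Proof.
apply: reach_le (max_card _) (reach_mix (base_coloring _) (base_coloring _) _) => u v uv.
have fuv := elimT (coloringP _ _) f_col u v uv.
have mixed a b : a != b -> pi (lift ord_max a) != (star i * pi)%g (lift ord_max b).
  move=> ab; rewrite permM (inj_eq perm_inj) /star; case: tpermP => [|/eqP|_ _].
  - by rewrite eq_sym neq_lift.
  - by rewrite eq_sym (negPf (neq_lift _ _)).
  - by rewrite (inj_eq (@lift_inj _ _)).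
by rewrite !ffunE; split; [exact: mixed|rewrite eq_sym; apply: mixed; rewrite eq_sym].
Qed.

(** The transpositions [star i] generate the symmetric group, and a path without repetition visits
    each permutation at most once. *)
Lemma reach_perm pi pi' :
  reach (single_change G) (#|{perm 'I_m.+1}| * #|V|) (base pi) (base pi').
Proof.
pose r : rel {perm 'I_m.+1} := fun p q => [exists i, q == (star i * p)%g].
have conn : connect r pi pi'.
  pose H := [set x : {perm 'I_m.+1} | [forall p, connect r p (x * p)%g]]%SET.
  have Hgroup : group_set H.
    apply/group_setP; split; first by rewrite inE; apply/forallP => p; rewrite mul1g connect0.
    move=> x y; rewrite !inE => /forallP xH /forallP yH; apply/forallP => p.
    by rewrite -mulgA; exact: connect_trans (yH p) (xH _).
  have : (<<[set tperm ord_max y | y in 'I_m.+1]>> \subset Group Hgroup)%g.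
    rewrite gen_subG; apply/fintype.subsetP => _ /imsetP[y _ ->]; rewrite inE; apply/forallP => p.
    case: (unliftP ord_max y) => [i ->|->]; last by rewrite tperm1 mul1g connect0.
    by apply: connect1; apply/existsP; exists i; rewrite tpermC.
  rewrite gen_tperm => /fintype.subsetP/(_ (pi' * pi^-1)%g); rewrite !inE => /(_ isT) /forallP/(_ pi).
  by rewrite mulgKV.
have /connectP[p0 p0P ->] := conn; case/shortenP: p0P => p rp up _ {p0 conn}.
have sp : size p <= #|{perm 'I_m.+1}|.
  by apply: ltnW; rewrite -[(size p).+1]/(size (pi :: p)) -(card_uniqP up) max_card.
apply: reach_le (leq_mul sp (leqnn _)) _ => {up sp}.
elim: p pi rp => [|q p IHp] pi0 /=; first by move=> _; exact: reach_refl.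
move=> /andP[/existsP[i /eqP ->] qp]; rewrite mulSn.
exact: reach_trans (reach_star _ _) (IHp _ qp).
Qed.

Lemma reach_few_colors alpha : (exists F, facet F) ->
  (exists gamma, [/\ coloring G gamma, num_colors gamma <= m & single_equivalent G alpha gamma]) ->
  exists pi, reach (single_change G) (#|V| * #|V|) alpha (base pi).
Proof.
move=> exF [gamma [gc gfew ag]]; have [F0 FF0] := exF.
have [pi0 gl] := lift_few_colors exF gc gfew.
have [h0 al0] := lifted_equivalent gl (eq_ind _ _ ag _ (single_equivalentC _ _)).
have [pi [h [al [F FF hF]]]] := lifted_rooted al0 FF0.
exists pi; apply: reach_le (reach_base al); rewrite -sum_nat_const leq_sum // => v _.
by apply/bigmax_leqP => F' /andP[FF' _]; exact: depth_le al FF hF FF'.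
Qed.

Lemma reach_colorings alpha beta : (exists F, facet F) ->
  (exists gamma, [/\ coloring G gamma, num_colors gamma <= m & single_equivalent G alpha gamma]) ->
  (exists delta, [/\ coloring G delta, num_colors delta <= m & single_equivalent G beta delta]) ->
  reach (single_change G) ((2 + #|{perm 'I_m.+1}|) * #|V| ^ 2) alpha beta.
Proof.
move=> exF /(reach_few_colors exF)[pi api] /(reach_few_colors exF)[pi' bpi].
have := reach_trans (reach_trans api (reach_perm pi pi'))
  (reach_sym (@single_changeC _ _ _) bpi).
apply: reach_le; rewrite mulnDl expnS expn1.
have [->|V0] := posnP #|V|; first by rewrite !muln0.
have : #|{perm 'I_m.+1}| * #|V| <= #|{perm 'I_m.+1}| * (#|V| * #|V|).
  by rewrite leq_mul2l leq_pmulr ?orbT.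
by move: (#|V| * #|V|) => a; lia.
Qed.

End BalancedComplex.

(** * The Poincare-Miranda theorem *)

Import Order.TTheory GRing.Theory Num.Theory.
Import numFieldNormedType.Exports.

Local Open Scope classical_set_scope.
Local Open Scope ring_scope.

Lemma F2_addrr (x : 'F_2) : (x + x = 0)%R.
Proof. by apply: addrr_pchar2; exact: pchar_Fp. Qed.

(** * A mod 2 labeling lemma for the Kuhn triangulation of the cube *)

Section Kuhn.
Variables (n N : nat).

(** The lowest corner of a grid cell and the order in which its coordinates are raised: [w.2 i] is
    the time of coordinate [i]. *)
Definition kuhn_simplex : finType := ({ffun 'I_n -> 'I_N.+1} * {perm 'I_n})%type.

Implicit Types (w : kuhn_simplex) (d : 'I_n) (t : nat) (i : 'I_n) (y z : {ffun 'I_n -> nat}).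

Definition kuhn_vertex w t : {ffun 'I_n -> nat} :=
  [ffun i => (w.1 i + (w.2 i < t))%N].

(** The vertices [d] to [n] of these simplices triangulate the face of the cube on which all
    coordinates below [d] equal [N.+1]. Fixing the first [d] raises makes the representation
    unique. *)
Definition kuhn_face (d : nat) : pred kuhn_simplex :=
  fun w => [forall i : 'I_n, (i < d)%N ==> (w.1 i == ord_max) && (w.2 i == i)].

Definition kuhn_swap (a b : 'I_n) w : kuhn_simplex := (w.1, (w.2 * tperm a b)%g).

Lemma kuhn_swapK a b : involutive (kuhn_swap a b).
Proof. by case=> x u; rewrite /kuhn_swap /= -mulgA tperm2 mulg1. Qed.

Lemma kuhn_face_swap (d : nat) (a b : 'I_n) w :
  (d <= a)%N -> (d <= b)%N -> kuhn_face d (kuhn_swap a b w) = kuhn_face d w.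
Proof.
move=> da db; apply: eq_forallb => i; case: ltnP => //= id.
have tpi : tperm a b i = i.
  by rewrite tpermD // -val_eqE /= neq_ltn (leq_trans id) ?orbT.
by rewrite permM -[X in _ && (_ == X)]tpi (inj_eq perm_inj).
Qed.

Lemma kuhn_vertex_swap (a b : 'I_n) w t : b = a.+1 :> nat -> t != b :> nat ->
  kuhn_vertex (kuhn_swap a b w) t = kuhn_vertex w t.
Proof.
move=> ba tb; apply/ffunP => i; rewrite !ffunE /= permM; congr (_ + nat_of_bool _)%N.
by case: tpermP => [->|->|//]; lia.
Qed.

Variable s : 'I_n -> {ffun 'I_n -> nat} -> 'F_2.
Hypothesis s_bot : forall i y, y i = 0%N -> s i y = 0.
Hypothesis s_top : forall i y, y i = N.+1 -> s i y = 1.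

Definition jump i y z : 'F_2 := s i y + s i z.

(* The vertex number [t] is skipped in the product of the jumps along the chain. *)
Definition jumps (d t : nat) w : 'F_2 :=
  \prod_(i < n | (d < i)%N)
     if (i <= t)%N then jump i (kuhn_vertex w i.-1) (kuhn_vertex w i)
     else jump i (kuhn_vertex w i) (kuhn_vertex w i.+1).

(** Modulo 2 the two products differ by one in which the jumps of label [t.+1] join up and vertex
    [t.+1] no longer occurs. Swapping the raises at times [t] and [t.+1] preserves such terms and
    pairs even with odd permutations, so they cancel. *)
Lemma sum_jumps_step (d : 'I_n) t : (d <= t)%N -> (t.+1 < n)%N ->
  \sum_(w | kuhn_face d w) s d (kuhn_vertex w d) * jumps d t.+1 w =
  \sum_(w | kuhn_face d w) s d (kuhn_vertex w d) * jumps d t w.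
Proof.
move=> dt tn; pose a : 'I_n := Ordinal (ltnW tn); pose b : 'I_n := Ordinal tn.
have ab : a != b by rewrite -val_eqE /=; lia.
pose G w := s d (kuhn_vertex w d) * (jumps d t.+1 w + jumps d t w).
have GE w : G (kuhn_swap a b w) = G w.
  have E v : jumps d t.+1 v + jumps d t v =
      (\prod_(i < n | (d < i)%N && (i != b))
        if (i <= t)%N then jump i (kuhn_vertex v i.-1) (kuhn_vertex v i)
        else jump i (kuhn_vertex v i) (kuhn_vertex v i.+1)) *
      jump b (kuhn_vertex v t) (kuhn_vertex v t.+2).
    rewrite /jumps (bigD1 b) //= [X in _ + X](bigD1 b) //= ltnn leqnn.
    rewrite (eq_bigr (fun i : 'I_n => if (i <= t)%N
        then jump i (kuhn_vertex v i.-1) (kuhn_vertex v i)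
        else jump i (kuhn_vertex v i) (kuhn_vertex v i.+1))); last first.
      move=> i /andP[_]; rewrite -val_eqE /= => ib.
      by have -> : (i <= t.+1)%N = (i <= t)%N by lia.
    rewrite -mulrDl mulrC; congr (_ * _); rewrite /jump.
    rewrite addrA -[X in X + _]addrA F2_addrr addr0; congr (_ + _).
  rewrite /G !E; congr (_ * (_ * _)).
  - by rewrite kuhn_vertex_swap //=; lia.
  - apply: eq_bigr => i /andP[_]; rewrite -val_eqE /= => ib.
    by case: leqP => it; rewrite !kuhn_vertex_swap //=; lia.
  - by rewrite !kuhn_vertex_swap //=; lia.
apply/eqP; rewrite -subr_eq0 (oppr_pchar2 (pchar_Fp (isT : prime 2))) -big_split /=.
under eq_bigr do rewrite -mulrDr -/(G _).
rewrite (bigID (fun w : kuhn_simplex => odd_perm w.2)) /=.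
rewrite [X in X + _](reindex_inj (inv_inj (kuhn_swapK a b))) /=.
under eq_bigl => w do rewrite kuhn_face_swap ?(leq_trans dt) //= odd_permM odd_tperm ab addbT.
by under eq_bigr do rewrite GE; rewrite F2_addrr.
Qed.

Lemma sum_jumps_last (d : 'I_n) :
  \sum_(w | kuhn_face d w) s d (kuhn_vertex w d) * jumps d n.-1 w =
  \sum_(w | kuhn_face d w) s d (kuhn_vertex w d) * jumps d d w.
Proof.
have H t : (d + t < n)%N ->
    \sum_(w | kuhn_face d w) s d (kuhn_vertex w d) * jumps d (d + t) w =
    \sum_(w | kuhn_face d w) s d (kuhn_vertex w d) * jumps d d w.
  elim: t => [|t IH] dt; first by rewrite addn0.
  rewrite addnS sum_jumps_step; [apply: IH | |]; lia.
have dn := ltn_ord d.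
by rewrite -(H (n.-1 - d)%N) ?subnKC //; lia.
Qed.

(** * Pivoting between neighboring Kuhn simplices *)

Lemma prev_subproof (j : 'I_n) : (j.-1 < n)%N. Proof. by have := ltn_ord j; lia. Qed.
Lemma last_subproof (j : 'I_n) : (n.-1 < n)%N. Proof. by have := ltn_ord j; lia. Qed.

(** Cyclic shift of the times from [d] on: time [d] goes to the end and the later ones come one
    earlier. *)
Definition rot_fun (d j : 'I_n) : 'I_n :=
  if (j < d)%N then j
  else if j == d then Ordinal (last_subproof d) else Ordinal (prev_subproof j).

Lemma rot_fun_inj d : injective (rot_fun d).
Proof.
move=> j k; rewrite /rot_fun => /(congr1 val) jk; apply: val_inj.
move: jk; rewrite -!val_eqE; have := (ltn_ord j, ltn_ord k, ltn_ord d).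
case=> -[/= ? ? ?].
by do 2 (case: ltnP => ? //=); do ?(case: eqP => ? //=); lia.
Qed.

Definition rot d : {perm 'I_n} := perm (@rot_fun_inj d).

Lemma rotE (d j : 'I_n) : nat_of_ord (rot d j) = (if j < d then nat_of_ord j else if j == d :> nat then n.-1 else j.-1)%N.
Proof. by rewrite permE /rot_fun; case: ifP => //; rewrite -val_eqE; case: ifP. Qed.

(** Drops vertex [d] and repeats its raise at the end. Under [kuhn_inner_next] the new corner stays
    in the grid, so [inord] returns the intended value. *)
Definition kuhn_next (d : 'I_n) w : kuhn_simplex :=
  ([ffun i => inord (w.1 i + (w.2 i == d))], (w.2 * rot d)%g).

Definition kuhn_prev (d : 'I_n) w : kuhn_simplex :=
  ([ffun i => inord (w.1 i - (w.2 i == n.-1 :> nat))], (w.2 * (rot d)^-1)%g).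

Definition kuhn_inner_next (d : 'I_n) w := (w.1 ((w.2)^-1%g d) < N)%N.
Definition kuhn_inner_prev (d : 'I_n) w :=
  (0 < w.1 ((w.2)^-1%g (Ordinal (last_subproof d))))%N.

Lemma kuhn_next_val d w i : kuhn_inner_next d w ->
  (kuhn_next d w).1 i = (w.1 i + (w.2 i == d))%N :> nat.
Proof.
move=> wN; rewrite ffunE inordK //; case: eqP => [wi|_].
  by move: wN; rewrite /kuhn_inner_next -wi permK; lia.
by rewrite addn0.
Qed.

Lemma kuhn_prev_val d w i : (kuhn_prev d w).1 i = (w.1 i - (w.2 i == n.-1 :> nat))%N :> nat.
Proof. by rewrite ffunE inordK // (leq_ltn_trans (leq_subr _ _)). Qed.

Lemma rotV_last d i : (((rot d)^-1)%g i == d) = (i == n.-1 :> nat).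
Proof.
rewrite -(inj_eq (@perm_inj _ (rot d))) permKV -val_eqE /= rotE ltnn.
by rewrite (eqxx (val d)).
Qed.

Lemma rot_last d i : (rot d i == n.-1 :> nat) = (i == d).
Proof. by rewrite -(rotV_last d) permK. Qed.

Lemma kuhn_nextK d w : kuhn_inner_next d w -> kuhn_prev d (kuhn_next d w) = w.
Proof.
case: w => x u wN; congr (_, _); last by rewrite /= mulgK.
apply/ffunP => i; apply: val_inj => /=.
rewrite (kuhn_prev_val d (kuhn_next d (x, u))) kuhn_next_val //= permM rot_last.
by rewrite addnK.
Qed.

Lemma kuhn_inner_next_prev d w : kuhn_inner_prev d w -> kuhn_inner_next d (kuhn_prev d w).
Proof.
rewrite /kuhn_inner_prev /kuhn_inner_next kuhn_prev_val /= invMg invgK permM.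
have -> : rot d d = Ordinal (last_subproof d).
  by apply: val_inj; rewrite /= rotE ltnn eqxx.
rewrite permKV /= eqxx; have := ltn_ord (w.1 ((w.2)^-1%g (Ordinal (last_subproof d)))).
move: (nat_of_ord _) => q; lia.
Qed.

Lemma kuhn_inner_prev_next d w : kuhn_inner_next d w -> kuhn_inner_prev d (kuhn_next d w).
Proof.
move=> wN; rewrite /kuhn_inner_prev kuhn_next_val //= invMg permM.
have -> : ((rot d)^-1)%g (Ordinal (last_subproof d)) = d.
  by apply/eqP; rewrite rotV_last.
by rewrite permKV eqxx addn1.
Qed.

Lemma kuhn_prevK d w : kuhn_inner_prev d w -> kuhn_next d (kuhn_prev d w) = w.
Proof.
move=> w0; have := kuhn_inner_next_prev w0; case: w w0 => x u w0 wN.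
congr (_, _); last by rewrite /= mulgKV.
apply/ffunP => i; apply: val_inj => /=.
rewrite (@kuhn_next_val d (kuhn_prev d (x, u))) // kuhn_prev_val /= permM rotV_last.
case: eqP => [ui|]; last by rewrite subn0 addn0.
move: w0; rewrite /kuhn_inner_prev /= => w0; rewrite subnK //.
suff ui' : u i = Ordinal (last_subproof d) by rewrite -ui' permK in w0.
exact: val_inj.
Qed.

Lemma kuhn_face_next (d : 'I_n) w : kuhn_face d w -> kuhn_face d (kuhn_next d w).
Proof.
move=> /forallP wd; apply/forallP => i; apply/implyP => id.
have /andP[/eqP w1 /eqP w2] := implyP (wd i) id.
rewrite permM -!val_eqE /= rotE ffunE w1 w2 id eqxx andbT.
by rewrite -val_eqE /= (ltn_eqF id) addn0 inordK.
Qed.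

Lemma kuhn_face_prev (d : 'I_n) w : kuhn_face d w -> kuhn_face d (kuhn_prev d w).
Proof.
move=> /forallP wd; apply/forallP => i; apply/implyP => id.
have /andP[/eqP w1 /eqP w2] := implyP (wd i) id.
apply/andP; split; apply/eqP; last first.
  by apply/(@perm_inj _ (rot d))/val_inj; rewrite permM permKV w2 /= rotE id.
apply/val_inj; rewrite /= (kuhn_prev_val d w) w1 w2 /=.
by have := ltn_ord d; case: eqP => [|_]; lia.
Qed.

Lemma kuhn_vertex_next (d : 'I_n) w t : kuhn_inner_next d w -> (d <= t < n)%N ->
  kuhn_vertex (kuhn_next d w) t = kuhn_vertex w t.+1.
Proof.
move=> wN dt; apply/ffunP => i; rewrite !ffunE -[RHS]/(_ + _)%N.
have := kuhn_next_val i wN; rewrite ffunE => ->.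
rewrite /= permM rotE -val_eqE /=; have := ltn_ord (w.2 i).
case/andP: dt => dt tn; case: (ltngtP (w.2 i) d) => wd; rewrite ?addn0 ?addn1 /= => wn; rewrite ?addSn -?addnS; congr (_ + _)%N; move: (nat_of_ord (w.2 i)) wd wn => q wd wn; lia.
Qed.

(** The face shared by two neighbors is counted on both sides, with vertices [d] to [n.-1] in one
    simplex and [d.+1] to [n] in the other. *)
Lemma sum_kuhn_next (d : 'I_n) :
  \sum_(w | kuhn_face d w && kuhn_inner_prev d w) s d (kuhn_vertex w d) * jumps d n.-1 w =
  \sum_(w | kuhn_face d w && kuhn_inner_next d w) s d (kuhn_vertex w d.+1) * jumps d d w.
Proof.
rewrite (reindex_onto (kuhn_next d) (kuhn_prev d)); last first.
  by move=> w /andP[_]; exact: kuhn_prevK.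
apply: eq_big => [w|w /andP[/andP[wd w0] /eqP wK]].
  apply/andP/andP => [[/andP[wd w0] /eqP <-]|[wd wN]].
    by split; [exact: kuhn_face_prev | exact: kuhn_inner_next_prev].
  by rewrite kuhn_face_next // kuhn_inner_prev_next // kuhn_nextK.
have wN : kuhn_inner_next d w by rewrite -wK; exact: kuhn_inner_next_prev.
have dn := ltn_ord d; congr (_ * _); first by rewrite kuhn_vertex_next // leqnn.
apply: eq_bigr => i di; have := ltn_ord i => ni.
have -> : (i <= n.-1)%N by rewrite -ltnS prednK // (leq_ltn_trans _ ni).
have i0 : (0 < i)%N by rewrite (leq_ltn_trans _ di).
rewrite leqNgt di /= (kuhn_vertex_next wN) ?prednK //; last first.
  by rewrite (ltnW ni) andbT -ltnS prednK.
by rewrite (kuhn_vertex_next wN) // ltnW.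
Qed.

Lemma leq_ord_pred d : (d <= n.-1)%N. Proof. by have := ltn_ord d; lia. Qed.

(** The coordinate raised last is 0 at all earlier vertices, so the bottom condition makes one
    factor of every term vanish. *)
Lemma sum_outer_prev (d : 'I_n) :
  \sum_(w | kuhn_face d w && ~~ kuhn_inner_prev d w) s d (kuhn_vertex w d) * jumps d n.-1 w = 0.
Proof.
apply: big1 => w /andP[/forallP wd]; rewrite -leqNgt leqn0; set e := (w.2)^-1%g _ => /eqP w0.
have ed : (d <= e)%N.
  rewrite leqNgt; apply/negP => ed; have /andP[_] := implyP (wd e) ed.
  by rewrite permKV => /eqP de; move: ed; rewrite -de /= ltnNge leq_ord_pred.
have we t : (t < n)%N -> kuhn_vertex w t e = 0%N.
  move=> tn; rewrite ffunE w0 permKV /= add0n ltnNge -ltnS prednK ?tn //.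
  exact: leq_ltn_trans tn.
have ne := ltn_ord e; case: (ltngtP d e) ed => // [de|/val_inj de] _.
  rewrite /jumps (bigD1 e) //= leq_ord_pred /jump.
  by rewrite !(s_bot (i := e)) ?we ?(leq_ltn_trans (leq_pred _) ne) // F2_addrr mul0r mulr0.
by rewrite s_bot ?mul0r // {2}de we // de.
Qed.

Definition kuhn_weight (d : nat) w : 'F_2 :=
  \prod_(i < n | (d <= i)%N) jump i (kuhn_vertex w i) (kuhn_vertex w i.+1).

Lemma jumps_weight d w : jumps d d w = kuhn_weight d.+1 w.
Proof. by apply: eq_bigr => i di; rewrite leqNgt di. Qed.

Lemma kuhn_weight_rec d w :
  kuhn_weight d w = jump d (kuhn_vertex w d) (kuhn_vertex w d.+1) * kuhn_weight d.+1 w.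
Proof.
rewrite /kuhn_weight (bigD1 d) //=; congr (_ * _); apply: eq_bigl => i.
by rewrite -val_eqE /= ltn_neqAle eq_sym andbC.
Qed.

(** The coordinate raised at time [d] is at the top afterwards. The term vanishes unless this
    coordinate is [d] itself, and the simplices that remain are those of the next face. *)
Lemma sum_outer_next (d : 'I_n) :
  \sum_(w | kuhn_face d w && ~~ kuhn_inner_next d w) s d (kuhn_vertex w d.+1) * jumps d d w =
  \sum_(w | kuhn_face d.+1 w) kuhn_weight d.+1 w.
Proof.
have top w : kuhn_face d w -> ~~ kuhn_inner_next d w -> w.1 ((w.2)^-1%g d) = ord_max.
  move=> _; rewrite -leqNgt => h; apply: val_inj; apply/eqP.
  by rewrite eqn_leq h -ltnS ltn_ord.
rewrite (bigID (fun w : kuhn_simplex => w.2 d == d)) /=.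
rewrite [X in _ + X]big1 ?addr0 => [|w /andP[/andP[wd wN] wdd]]; last first.
  have := top _ wd wN; set e := (w.2)^-1%g d => we.
  have ed : (d <= e)%N.
    rewrite leqNgt; apply/negP => ed; have /andP[_] := implyP (forallP wd e) ed.
    by rewrite permKV => /eqP de; rewrite -de ltnn in ed.
  have {}ed : (d < e)%N.
    rewrite ltn_neqAle ed andbT; apply: contra wdd => /eqP /val_inj de.
    by rewrite {1}de /e permKV.
  rewrite jumps_weight /kuhn_weight (bigD1 e) //= /jump.
  have wt t : (d < t)%N -> kuhn_vertex w t e = N.+1.
    by move=> dt; rewrite ffunE we permKV dt addn1.
  by rewrite !(s_top (i := e)) ?wt ?F2_addrr ?mul0r ?mulr0 // ltnS ltnW.
apply: eq_big => [w|w /andP[/andP[wd wN] /eqP wdd]].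
  apply/andP/forallP => [[/andP[wd wN] /eqP wdd] i|wd].
    apply/implyP; rewrite ltnS leq_eqVlt => /orP[/eqP /val_inj ->|id].
      by rewrite wdd eqxx andbT -{1}wdd; apply/eqP; rewrite -[RHS](top _ wd wN) -{2}wdd permK wdd.
    exact: implyP (forallP wd i) id.
  have /andP[/eqP w1 /eqP w2] := implyP (wd d) (leqnn _).
  rewrite w2 eqxx /kuhn_inner_next -{2}w2 permK w1 ltnn andbT; split=> //.
  by apply/forallP => i; apply/implyP => id; apply: (implyP (wd i)); exact: ltnW.
rewrite jumps_weight s_top ?mul1r // ffunE wdd ltnSn addn1.
by have := top _ wd wN; rewrite -{1}wdd permK => ->.
Qed.

(** A discrete Stokes formula modulo 2: inner faces cancel in pairs, the bottom contributes nothing,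
    and the top leaves a cube of one dimension less. *)
Lemma sum_kuhn_weight_rec (d : 'I_n) :
  \sum_(w | kuhn_face d w) kuhn_weight d w = \sum_(w | kuhn_face d.+1 w) kuhn_weight d.+1 w.
Proof.
under eq_bigr do rewrite kuhn_weight_rec -jumps_weight mulrDl.
rewrite big_split /= -sum_jumps_last -sum_outer_next.
rewrite (bigID (kuhn_inner_prev d)) /= sum_outer_prev addr0 sum_kuhn_next.
by rewrite [X in _ + X](bigID (kuhn_inner_next d)) /= addrA F2_addrr add0r.
Qed.

Lemma sum_kuhn_weight : \sum_w kuhn_weight 0 w = 1.
Proof.
have H (d : nat) : (d <= n)%N ->
    \sum_(w | kuhn_face 0 w) kuhn_weight 0 w = \sum_(w | kuhn_face d w) kuhn_weight d w.
  elim: d => // d IH dn; rewrite IH ?(ltnW dn) //.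
  exact: (sum_kuhn_weight_rec (Ordinal dn)).
transitivity (\sum_(w | kuhn_face 0 w) kuhn_weight 0 w).
  by apply: eq_bigl => w; apply/esym/forallP => i.
(* At [d = n] a single simplex remains, with an empty product. *)
rewrite (H n) // (big_pred1 ([ffun=> ord_max], 1%g)).
  by apply: big1 => i; rewrite leqNgt ltn_ord.
case=> x u; apply/forallP/eqP => [H'|[-> ->] i]; last first.
  by rewrite ltn_ord ffunE perm1 !eqxx.
congr (_, _); [apply/ffunP|apply/permP] => i; rewrite ?ffunE ?perm1;
  by have := H' i; rewrite ltn_ord /= => /andP[/eqP ? /eqP ?].
Qed.

(* Cohomologically: the cup product of the coboundaries of the [s i] is nonzero. *)
Lemma kuhn_cube : exists w : kuhn_simplex,
  [forall i : 'I_n, s i (kuhn_vertex w i) != s i (kuhn_vertex w i.+1)].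
Proof.
apply/existsP; apply: contraTT isT; rewrite negb_exists => /forallP H.
suff : \sum_w kuhn_weight 0 w == 0 by rewrite sum_kuhn_weight.
rewrite big1 // => w _; have := H w; rewrite negb_forall => /existsP[i].
rewrite negbK => /eqP si; rewrite /kuhn_weight (bigD1 i) //= /jump si.
by rewrite F2_addrr mul0r.
Qed.

End Kuhn.

(** * From labeled grids to zeros of continuous maps *)

Section PoincareMiranda.
Variables (R : realType) (n : nat).

Definition cube (r : R) : set 'rV[R]_n := [set x | forall i, `|x ord0 i| <= r].

Lemma cube_compact r : compact (cube r).
Proof.
have -> : cube r = [set x : 'rV[R]_n | forall i, `[- r, r]%classic (x ord0 i)].
  by apply/seteqP; split=> x h i; have := h i; rewrite /= in_itv /= ler_norml.
by apply: (@rV_compact _ n (fun=> `[- r, r]%classic)) => i; exact: segment_compact.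
Qed.

Lemma near_rowP (x : 'rV[R]_n) (P : set 'rV[R]_n) :
  (\forall y \near x, P y) <->
  exists2 e, 0 < e & forall y : 'rV[R]_n, (forall i, `|x ord0 i - y ord0 i| < e) -> P y.
Proof.
split=> [/nbhs_ballP[e /= e0 eP]|[e e0 eP]].
  by exists e => // y xy; apply: eP; split=> // i j; rewrite (ord1 i); exact: xy.
by apply/nbhs_ballP; exists e => //= y [_ xy]; apply: eP => i; exact: xy.
Qed.

(** Without a zero, compactness gives a grid so fine that around each point some [G i] keeps its
    sign over one grid step. Labeling by signs then contradicts [kuhn_cube], as the vertices of a
    Kuhn simplex are within one step of vertex 0. *)
Theorem poincare_miranda (r : R) (G : 'I_n -> 'rV[R]_n -> R) :
  0 < r -> (forall i, continuous (G i)) ->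
  (forall i x, cube r x -> x ord0 i = - r -> G i x < 0) ->
  (forall i x, cube r x -> x ord0 i = r -> 0 < G i x) ->
  exists2 x, cube r x & forall i, G i x = 0.
Proof.
move=> r0 Gc Glo Ghi; apply: contrapT => nozero.
pose const_sign (N : nat) (x : 'rV[R]_n) := exists i b, forall y : 'rV[R]_n,
  (forall j, `|x ord0 j - y ord0 j| <= (2 * r) / N.+1%:R) -> (0 < G i y) = b.
have [N _ /(_ _ (leqnn N)) constN] : \forall N \near \oo, cube r `<=` const_sign N.
  have /compact_near_coveringP cov := @cube_compact r.
  apply: cov => x rx.
  have [i Gi] : exists i, G i x != 0.
    apply: contrapT => /forallNP h; apply: nozero; exists x => // i.
    by apply/eqP; have /negP := h i; rewrite negbK.
  have [e e0 eP] : exists2 e, 0 < e & forall y : 'rV[R]_n,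
      (forall i, `|x ord0 i - y ord0 i| < e) -> (0 < G i y) = (0 < G i x).
    apply/near_rowP; have [Gx|Gx] := ltP 0 (G i x).
      have : \forall y \near x, 0 < G i y.
        exact: cvgr_gt (Gc i x) _ Gx.
      by apply: filterS => y ->.
    have {}Gx : G i x < 0 by rewrite lt_neqAle Gi.
    have : \forall y \near x, G i y < 0.
      exact: cvgr_lt (Gc i x) _ Gx.
    by apply: filterS => y Gy; rewrite ltNge ltW.
  have e20 : 0 < e / 2 by rewrite divr_gt0.
  have e' : 0 < e / 2 / (2 * r) by rewrite divr_gt0 ?mulr_gt0.
  near=> x' N; exists i, (0 < G i x) => y yx'; apply: eP => j.
  have H1 : `|x ord0 j - x' ord0 j| < e / 2.
    by move: (j); near: x'; apply/near_rowP; exists (e / 2).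
  have H2 : (2 * r) / N.+1%:R < e / 2.
    rewrite mulrC -ltr_pdivlMr ?mulr_gt0 //.
    by near: N; exact: (near_infty_natSinv_lt (PosNum e')).
  rewrite -(subrKA (x' ord0 j)) (le_lt_trans (ler_normD _ _)) //.
  by rewrite (splitr e) ltrD // (le_lt_trans (yx' j)).
(* Truncation by [minn] keeps [pt y] in the cube for every [y]. *)
pose pt (y : {ffun 'I_n -> nat}) : 'rV[R]_n :=
  \row_j (2 * r * (minn (y j) N.+1)%:R / N.+1%:R - r).
have N0 : 0 < N.+1%:R :> R by rewrite ltr0n.
have pt_cube y : cube r (pt y).
  move=> j; rewrite mxE ler_norml.
  rewrite -mulrA; set q : R := _ / _.
  have q0 : 0 <= q by rewrite divr_ge0.
  have q1 : q <= 1 by rewrite ler_pdivrMr // mul1r ler_nat geq_minr.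
  by apply/andP; split; nra.
pose s i y : 'F_2 := if 0 < G i (pt y) then 1 else 0.
have [i y yi|i y yi|w /forallP /= sw] := @kuhn_cube n N s.
- rewrite /s ltNge ltW ?Glo ?mxE ?yi ?min0n ?mulr0 ?mul0r ?add0r //.
- by rewrite /s Ghi // mxE yi minnn -mulrA divff ?gt_eqF //; lra.
have [i [b ib]] := constN _ (pt_cube (kuhn_vertex w 0)).
have near_base t : (0 < G i (pt (kuhn_vertex w t))) = b.
  apply: ib => j; rewrite !mxE opprB addrA subrK -mulrBl -mulrBr normrM.
  rewrite [`|_^-1|]ger0_norm ?invr_ge0 // ler_pM2r ?invr_gt0 //.
  have r2 : 0 < 2 * r by rewrite mulr_gt0.
  rewrite normrM [`|2 * r|]gtr0_norm // -[leRHS]mulr1 ler_pM2l // !ffunE ltn0 addn0.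
  have := ltn_ord (w.1 j); move: (nat_of_ord (w.1 j)) => x xN.
  case: (w.2 j < t)%N; last by rewrite addn0 subrr normr0.
  rewrite addn1 !(minn_idPl _) ?(ltnW xN) //.
  by rewrite -[x.+1]addn1 natrD opprD addrA subrr add0r normrN normr1.
by have := sw i; rewrite /s !near_base eqxx.
Unshelve. all: by end_near. Qed.

End PoincareMiranda.

(** * Low-dimensional sets do not separate *)

(* A pigeonhole count on two grids replaces the measure-zero argument. *)
Lemma lipschitz_image_avoids (R : realType) n (I J : finType) (X : Type)
    (e : J -> X -> I -> R) (Q : J -> X -> 'rV[R]_n) (S L r : R) :
  (#|I| < n)%N -> 0 < r -> (forall j x i, 0 <= e j x i <= S) ->
  (forall j x x' d, 0 <= d -> (forall i, `|e j x i - e j x' i| <= d) ->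
    forall l, `|Q j x ord0 l - Q j x' ord0 l| <= L * d) ->
  exists2 c : 'rV[R]_n, cube r c & forall j x, Q j x <> c.
Proof.
move=> In r0 eS QL; apply: contrapT => noc.
have hit c : cube r c -> exists jx : J * X, Q jx.1 jx.2 = c.
  move=> rc; apply: contrapT => /forallNP h; apply: noc; exists c => // j x Qc.
  exact: (h (j, x)).
(* [t] makes [L / t] smaller than [r], so preimages in a common cell of side [1 / (t * N)] have
   images closer than the grid step [r / N]; [s] bounds [S]. *)
pose t := (Num.bound `|L / r|).+1; pose s := Num.bound `|S|.
(* Large enough for the [N ^ n] grid points to outnumber the cells. *)
pose N := (#|J| * (s * t).+1 ^ #|I|).+1.
have NR : 0 < N%:R :> R by rewrite ltr0n.
have tR : 0 < t%:R :> R by rewrite ltr0n.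
pose grid (g : {ffun 'I_n -> 'I_N}) : 'rV[R]_n := \row_l (r * (g l)%:R / N%:R).
have grid_cube g : cube r (grid g).
  move=> l; rewrite mxE ger0_norm ?divr_ge0 ?mulr_ge0 ?ler0n ?(ltW r0) //.
  by rewrite ler_pdivrMr // ler_pM2l // ler_nat ltnW.
have [pre preP] : exists pre : {ffun 'I_n -> 'I_N} -> J * X,
    forall g, Q (pre g).1 (pre g).2 = grid g.
  by exists (fun g => projT1 (cid (hit _ (grid_cube g)))) => g; case: cid.
pose cell g : J * {ffun I -> 'I_(s * t * N).+1} :=
  ((pre g).1, [ffun i => inord (Num.truncn (e (pre g).1 (pre g).2 i * (t * N)%:R))]).
have tN0 : 0 < (t * N)%:R :> R by rewrite ltr0n muln_gt0.
have cell_inj : injective cell.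
  move=> g g' [jj] /ffunP ee.
  have close i : `|e (pre g).1 (pre g).2 i - e (pre g).1 (pre g').2 i| <= (t * N)%:R^-1.
    rewrite -[leRHS]mul1r ler_pdivlMr // -[X in _ * X <= _](gtr0_norm tN0) -normrM mulrBl.
    have := ee i; rewrite !ffunE jj => /(congr1 val) /=.
    have in_cell h : (Num.truncn (e (pre h).1 (pre h).2 i * (t * N)%:R) < (s * t * N).+1)%N.
      have /andP[e0 eS'] := eS (pre h).1 (pre h).2 i.
      have ge0 := mulr_ge0 e0 (ltW tN0).
      rewrite ltnS -(ler_nat R) (@le_trans _ _ (e (pre h).1 (pre h).2 i * (t * N)%:R)) ?truncn_le //.
      rewrite -mulnA [leRHS]natrM ler_wpM2r ?(ltW tN0) // (le_trans eS') //.
      by rewrite ltW // (le_lt_trans (ler_norm _)) // archi_boundP.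
    have := in_cell g; rewrite jj => ig.
    rewrite !inordK // => tt.
    have itv h := truncn_itv (mulr_ge0 (proj1 (andP (eS (pre g').1 h i))) (ltW tN0)).
    have := itv (pre g).2; rewrite tt; have := itv (pre g').2.
    move: (Num.truncn _) => q.
    rewrite -natr1.
    by move=> /andP[? ?] /andP[? ?]; rewrite ler_norml; apply/andP; split; lra.
  apply/ffunP => l; apply/val_inj => /=.
  have := QL _ _ _ _ _ close l; rewrite {2}jj !preP !mxE invr_ge0 (ltW tN0) => /(_ isT).
  have Lt : L / (t * N)%:R < r / N%:R.
    rewrite natrM invfM mulrA ltr_pM2r ?invr_gt0 // ltr_pdivrMr // -ltr_pdivrMl // mulrC.
    rewrite (le_lt_trans (ler_norm _)) // (lt_trans (archi_boundP _)) //.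
    by rewrite ltr_nat.
  move=> /le_lt_trans /(_ Lt); rewrite -mulrBl -mulrBr !normrM.
  rewrite [`|r|]gtr0_norm // [`|_^-1|]gtr0_norm ?invr_gt0 // ltr_pM2r ?invr_gt0 //.
  rewrite -[ltRHS]mulr1 ltr_pM2l //.
  have dist a b : (a < b)%N -> (1 : R) <= b%:R - a%:R.
    by move=> ab; rewrite lerBrDr addrC natr1 ler_nat.
  move=> /ltr_normlP[d1 d2].
  by case: (ltngtP (g l) (g' l)) => // /dist d3; exfalso; lra.
have := leq_card _ cell_inj; rewrite card_prod !card_ffun !card_ord.
apply/negP; rewrite -ltnNge.
apply: (@leq_ltn_trans (#|J| * ((s * t).+1 * N) ^ #|I|)).
  rewrite leq_mul2l; apply/orP; right; have [->//|I0] := posnP #|I|.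
  by rewrite leq_exp2r //; lia.
rewrite expnMn mulnA (@leq_trans (N ^ #|I|.+1)) ?leq_pexp2l //.
by rewrite expnS ltn_pmul2r ?expn_gt0.
Qed.

Lemma compact_pos_bound (R : realType) (T : topologicalType) (K : set T) (h : T -> R) :
  compact K -> continuous h -> (forall x, K x -> 0 < h x) ->
  exists2 e, 0 < e & forall x, K x -> e <= h x.
Proof.
move=> Kc hc h0; have [[x Kx]|K0] := pselect (K !=set0); last first.
  by exists 1 => // x Kx; case: K0; exists x.
have [c cK cmin] := compact_EVT_min (ex_intro _ x Kx) Kc (continuous_subspaceT hc).
rewrite inE in cK; exists (h c); first exact: h0.
by move=> y Ky; apply: cmin; rewrite inE.
Qed.

(** * Continuity of real-valued expressions *)

Section RealContinuity.
Variables (R : realType) (T : topologicalType).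
Implicit Types f g : T -> R.

Lemma ctsD f g : continuous f -> continuous g -> continuous (fun x => f x + g x).
Proof. by move=> fc gc x; exact: (continuousD (fc x) (gc x)). Qed.

Lemma ctsB f g : continuous f -> continuous g -> continuous (fun x => f x - g x).
Proof. by move=> fc gc x; exact: (continuousB (fc x) (gc x)). Qed.

Lemma ctsM f g : continuous f -> continuous g -> continuous (fun x => f x * g x).
Proof. by move=> fc gc x; exact: (continuousM (fc x) (gc x)). Qed.

Lemma cts_norm f : continuous f -> continuous (fun x => `|f x|).
Proof. by move=> fc x; apply: (continuous_comp (fc x)); exact: norm_continuous. Qed.

Lemma cts_cst (c : R) : continuous (fun _ : T => c).
Proof. by move=> x; exact: cst_continuous. Qed.

Lemma cts_max f g : continuous f -> continuous g -> continuous (fun x => Num.max (f x) (g x)).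
Proof. by move=> fc gc x; exact: (continuous_max (fc x) (gc x)). Qed.

Lemma cts_min f g : continuous f -> continuous g -> continuous (fun x => Num.min (f x) (g x)).
Proof. by move=> fc gc x; exact: (continuous_min (fc x) (gc x)). Qed.

Lemma cts_sum (I : finType) (P : pred I) (f : I -> T -> R) :
  (forall i, continuous (f i)) -> continuous (fun x => \sum_(i | P i) f i x).
Proof. by move=> fc; apply: continuous_big => [|i _]; [exact: add_continuous|exact: fc]. Qed.

End RealContinuity.

Lemma cts_comp (S T U : topologicalType) (f : S -> T) (g : T -> U) :
  continuous f -> continuous g -> continuous (fun x => g (f x)).
Proof. by move=> fc gc x; exact: (continuous_comp (fc x) (gc (f x))). Qed.

Lemma cts_fst (S T : topologicalType) : continuous (@fst S T).
Proof. by move=> x; exact: cvg_fst. Qed.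

Lemma cts_snd (S T : topologicalType) : continuous (@snd S T).
Proof. by move=> x; exact: cvg_snd. Qed.

(** * Approximating the identity by a map that is Lipschitz in the coordinates [psi] *)

Section LipschitzApproximation.
Variables (R : realType) (n : nat) (V : finType).
Variables (psi : V -> 'rV[R]_n -> R) (r eta : R).
Hypothesis psi_cont : forall v, continuous (psi v).
Hypothesis psi_inj : forall x z, cube r x -> cube r z -> (forall v, psi v x = psi v z) -> x = z.
Hypotheses (r_gt0 : 0 < r) (eta_gt0 : 0 < eta).

Let dist x z := \sum_v `|psi v x - psi v z|.

(** Infimal convolution of coordinate [l] with [M * dist], as in McShane's extension of Lipschitz
    functions. By compactness, points of the cube whose coordinates [l] differ by at least [eta]
    have [dist] at least [mu]. *)
Lemma lipschitz_approx_coord l : exists (p : 'rV[R]_n -> R) (M : R),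
  [/\ 0 <= M, forall x, cube r x -> `|p x - x ord0 l| <= eta &
      forall x x', p x <= p x' + M * dist x x'].
Proof.
have dist_ge0 x z : 0 <= dist x z by exact: sumr_ge0.
have [mu mu0 muP] : exists2 mu, 0 < mu & forall xz : 'rV[R]_n * 'rV[R]_n,
    (cube r `*` cube r) xz ->
    mu <= dist xz.1 xz.2 + Num.max 0 (eta - `|xz.1 ord0 l - xz.2 ord0 l|).
  apply: compact_pos_bound.
  - by apply: compact_setX; exact: cube_compact.
  - apply: ctsD.
      apply: cts_sum => v; apply: cts_norm; apply: ctsB.
        by apply: (cts_comp (@cts_fst _ _)); exact: psi_cont.
      by apply: (cts_comp (@cts_snd _ _)); exact: psi_cont.
    apply: cts_max; first exact: cts_cst.
    apply: ctsB; first exact: cts_cst.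
    apply: cts_norm; apply: ctsB.
      exact: (cts_comp (@cts_fst _ _) (@coord_continuous _ _ _ ord0 l)).
    exact: (cts_comp (@cts_snd _ _) (@coord_continuous _ _ _ ord0 l)).
  - move=> [x z] [/= rx rz]; rewrite lt_neqAle addr_ge0 ?le_max ?lexx // andbT eq_sym.
    apply/negP; rewrite paddr_eq0 ?le_max ?lexx // psumr_eq0 // => /andP[/allP d0].
    have xz : forall v, psi v x = psi v z.
      move=> v; apply/eqP; rewrite -subr_eq0 -normr_eq0.
      exact: (d0 v (mem_index_enum v)).
    rewrite (psi_inj rx rz xz).
    by rewrite subrr normr0 subr0 max_r ?(ltW eta_gt0) // gt_eqF.
(* From distance [mu] on, the penalty is at least the width [2 * r] of the cube. *)
pose M := 2 * r / mu; have M0 : 0 <= M by rewrite divr_ge0 ?mulr_ge0 // ltW.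
pose E x := [set z ord0 l + M * dist x z | z in cube r].
have cube0 : cube r (0 : 'rV[R]_n) by move=> i; rewrite mxE normr0 ltW.
have E0 x : E x !=set0 by exists ((0 : 'rV[R]_n) ord0 l + M * dist x 0), 0.
have Elb x : has_lbound (E x).
  exists (- r) => _ [z rz <-]; have := rz l; rewrite ler_norml => /andP[+ _].
  by move=> zl; rewrite (le_trans zl) // lerDl mulr_ge0.
exists (fun x => inf (E x)), M; split=> // [x rx|x x'].
  rewrite ler_distl; apply/andP; split; last first.
    apply: (@le_trans _ _ (x ord0 l)); last by rewrite lerDl ltW.
    apply: ge_inf => //; exists x => //; rewrite /dist big1 ?mulr0 ?addr0 // => v _.
    by rewrite subrr normr0.
  apply: lb_le_inf => // _ [z rz <-].
  have := muP (x, z) (conj rx rz) => /=.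
  have := dist_ge0 x z; move: (dist x z) => d d0.
  have [|xz] := leP eta `|x ord0 l - z ord0 l|; last first.
    have := ler_norm (x ord0 l - z ord0 l); have := mulr_ge0 M0 d0; lra.
  move=> xz; rewrite max_l ?subr_le0 // addr0 => mud.
  have Md : 2 * r <= M * d by rewrite -[leLHS](divfK (lt0r_neq0 mu0)) ler_wpM2l.
  have := rx l; have := rz l; rewrite !ler_norml => /andP[? ?] /andP[? ?].
  have := eta_gt0; lra.
rewrite -lerBlDr; apply: lb_le_inf => // _ [z rz <-].
rewrite lerBlDr (@le_trans _ _ (z ord0 l + M * dist x z)) //.
  by apply: ge_inf => //; exists z.
rewrite -addrA lerD2l -mulrDr ler_wpM2l // -big_split /= ler_sum // => v _.
by rewrite addrC -[X in `|X|](subrKA (psi v x')) ler_normD.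
Qed.

Lemma lipschitz_approx : exists (P : 'rV[R]_n -> 'rV[R]_n) (M : R),
  [/\ forall x, cube r x -> forall l, `|P x ord0 l - x ord0 l| <= eta,
      forall x x' d, 0 <= d -> (forall v, `|psi v x - psi v x'| <= d) ->
        forall l, `|P x ord0 l - P x' ord0 l| <= M * d &
      forall l, continuous (fun x => P x ord0 l)].
Proof.
have /(_ _)/cid H := lipschitz_approx_coord.
pose p l := projT1 (H l); pose M l := projT1 (cid (projT2 (H l))).
have pP l : [/\ 0 <= M l, forall x, cube r x -> `|p l x - x ord0 l| <= eta &
      forall x x', p l x <= p l x' + M l * dist x x'] by rewrite /M; case: cid.
have distC x x' : dist x x' = dist x' x by apply: eq_bigr => v _; rewrite distrC.
have dp l x x' : `|p l x - p l x'| <= M l * dist x x'.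
  have [_ _ pM] := pP l.
  rewrite ler_norml; have := pM x x'; have := pM x' x; rewrite (distC x' x).
  by move=> ? ?; apply/andP; split; lra.
exists (fun x => \row_l p l x), ((\sum_l M l) * #|V|%:R); split=> [x rx l|x x' d d0 xd l|l].
- by rewrite mxE; have [_ + _] := pP l; apply.
- rewrite !mxE (le_trans (dp _ _ _)) // -mulrA ler_pM //.
  + by have [] := pP l.
  + exact: sumr_ge0.
  + by rewrite (bigD1 l) //= lerDl sumr_ge0 // => i _; have [] := pP i.
  + rewrite -sum1_card natr_sum mulr_suml ler_sum // => v _; rewrite mul1r; exact: xd.
- have -> : (fun x => (\row_l p l x) ord0 l) = p l by apply/funext => y; rewrite mxE.
  move=> x.
  apply/(@cvgrPdist_le R R^o _ (nbhs x) (nbhs_filter x) (p l) (p l x)) => e e0.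
  have dc : continuous (fun y => M l * dist x y).
    apply: ctsM; first exact: cts_cst.
    apply: cts_sum => v; apply: cts_norm; apply: ctsB; [exact: cts_cst|exact: psi_cont].
  have dx0 : M l * dist x x < e.
    by rewrite /dist big1 ?mulr0 // => v _; rewrite subrr normr0.
  have : \forall y \near x, M l * dist x y < e by exact: cvgr_lt (dc x) _ dx0.
  by apply: filterS => y /ltW; apply: le_trans.
Qed.
End LipschitzApproximation.

(** * The l1 norm *)

Section L1Norm.
Variables (R : realType) (n : nat).

Definition l1 (x : 'rV[R]_n) : R := \sum_l `|x ord0 l|.

Implicit Types x y : 'rV[R]_n.

Lemma l1_gt0 x : (0 < l1 x) = (x != 0).
Proof.
have l10 : 0 <= l1 x by apply: sumr_ge0.
rewrite lt_neqAle l10 andbT eq_sym psumr_eq0 //; congr (~~ _).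
apply/allP/eqP => [h|-> l _]; last by rewrite /= mxE normr0 eqxx.
by apply/rowP => l; rewrite mxE; apply/eqP; rewrite -normr_eq0; exact: (h l (mem_index_enum l)).
Qed.

Lemma l1D x y : l1 (x + y) <= l1 x + l1 y.
Proof. by rewrite -big_split ler_sum // => l _; rewrite mxE ler_normD. Qed.

Lemma l1N x : l1 (- x) = l1 x.
Proof. by apply: eq_bigr => l _; rewrite mxE normrN. Qed.

Lemma l1Z (k : R) x : l1 (k *: x) = `|k| * l1 x.
Proof. by rewrite mulr_sumr; apply: eq_bigr => l _; rewrite mxE normrM. Qed.

Lemma l1_le x (d : R) : (forall l, `|x ord0 l| <= d) -> l1 x <= n%:R * d.
Proof.
move=> xd; rewrite (le_trans (ler_sum _ (fun l _ => xd l))) //.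
by rewrite sumr_const card_ord mulr_natl.
Qed.

Lemma l1_ge0 x : 0 <= l1 x.
Proof. exact: sumr_ge0. Qed.

End L1Norm.

(** * Sets controlled by few coordinates *)

Section LowDimensional.
Variables (R : realType) (n : nat) (V : finType).
Variables (psi : V -> 'rV[R]_n -> R) (r : R).
Hypothesis psi_cont : forall v, continuous (psi v).
Hypothesis psi01 : forall v x, 0 <= psi v x <= 1.
Hypothesis psi_inj : forall x z, cube r x -> cube r z -> (forall v, psi v x = psi v z) -> x = z.
Hypothesis r_gt0 : 0 < r.

(* The image of [Z] under [psi] has dimension at most [#|I|]. *)
Definition controlled (I : {set V}) (Z : set 'rV[R]_n) := exists2 A : R, 0 <= A &
  forall x x' d, Z x -> Z x' -> 0 <= d -> (forall v, v \in I -> `|psi v x - psi v x'| <= d) ->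
    forall v, `|psi v x - psi v x'| <= A * d.

(** An approximation of the identity that is Lipschitz in fewer than [n] parameters misses a point
    near the center, yet by Poincare-Miranda it attains every such point. *)
Lemma no_low_dim_chart (I : {set V}) : (#|I| < n)%N -> ~ controlled I (cube r).
Proof.
move=> In [A A0 ctrl].
have [|P [M [Pnear PM Pc]]] := @lipschitz_approx R n V psi r (r / 4) psi_cont psi_inj r_gt0.
  by rewrite divr_gt0.
pose X := {x : 'rV[R]_n | cube r x}.
pose e (_ : unit) (x : X) (i : {v | v \in I}) := psi (val i) (projT1 x).
pose Q (_ : unit) (x : X) := P (projT1 x).
have [||j x|j x x' d d0 xd l|c c4 Pnc] := @lipschitz_image_avoids R n {v | v \in I} unit X e Q 1 (M * A) (r / 4).
- by rewrite card_sig.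
- by rewrite divr_gt0.
- by move=> i; exact: psi01.
- rewrite -mulrA; apply: PM; first by rewrite mulr_ge0.
  apply: ctrl => //; [exact: (projT2 x)|exact: (projT2 x')|].
  by move=> v vI; exact: (xd (exist _ v vI)).
pose G l x := P x ord0 l - c ord0 l.
have [|l x rx xl|l x rx xl|x rx Gx] := @poincare_miranda R n r G r_gt0.
- by move=> l; apply: ctsB; [exact: Pc|exact: cts_cst].
- have := r_gt0; have := Pnear x rx l; have := c4 l; rewrite /G !ler_norml xl => /andP[? ?] /andP[? ?] ?; lra.
- have := r_gt0; have := Pnear x rx l; have := c4 l; rewrite /G !ler_norml xl => /andP[? ?] /andP[? ?] ?; lra.
apply: (Pnc tt (exist _ x rx)); apply/rowP => l.
by apply/eqP; rewrite -subr_eq0; apply/eqP; exact: Gx.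
Qed.

(** * A zero set of low dimension does not separate the cube *)

Section Separation.
Variables (m : 'rV[R]_n -> R) (a : bool -> 'rV[R]_n) (I : {set V}).
Hypothesis m_cont : continuous m.
Hypothesis a_small : forall j l, `|a j ord0 l| <= r / 4.
Hypotheses (ma_true : 0 < m (a true)) (ma_false : m (a false) < 0).
Hypothesis In : (#|I|.+1 < n)%N.
Hypothesis ctrlZ : controlled I [set x | cube r x /\ m x = 0].

Lemma dist_from_a j : exists2 mu, 0 < mu & forall x, cube r x -> m x = 0 -> mu <= l1 (x - a j).
Proof.
have [|x _|mu mu0 muP] := @compact_pos_bound R _ _ (fun x => `|m x| + l1 (x - a j)) (@cube_compact R n r).
- apply: ctsD; first exact: cts_norm m_cont.
  apply: cts_sum => l; apply: cts_norm.
  have -> : (fun x : 'rV[R]_n => (x - a j) ord0 l) = (fun x => x ord0 l - a j ord0 l).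
    by apply/funext => x; rewrite !mxE.
  by apply: ctsB; [exact: coord_continuous|exact: cts_cst].
- have [->|xa] := eqVneq x (a j).
    rewrite ltr_wpDr ?sumr_ge0 // normr_gt0.
    by case: j => /=; [rewrite gt_eqF|rewrite lt_eqF].
  by rewrite ltr_wpDl // l1_gt0 subr_eq0.
by exists mu => // x rx mx; have := muP x rx; rewrite mx normr0 add0r.
Qed.

(* The homotopy pushes the identity to an approximation of lower dimension,
   and then moves the omitted point from [a j] to the generic point [c]. *)
Definition push (P : 'rV[R]_n -> 'rV[R]_n) (c : 'rV[R]_n) j (x : 'rV[R]_n) (t : R) :=
  P x + Num.max 0 (t - 1) *: (x - P x) - c - Num.min 1 t *: (a j - c).

(** For [t <= 1] a zero of [push] puts [c] on the ray from [a j] through [P x]. Over the zero set of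
    [m] these rays have [#|I|.+1 < n] parameters, so some [c] is off all of them. For [t > 1] the
    path from [P x] to [x] avoids [a j] because [P] is close to the identity. *)
Lemma generic_push : exists (P : 'rV[R]_n -> 'rV[R]_n) (c : 'rV[R]_n),
  [/\ forall l, continuous (fun x => P x ord0 l),
      forall x, cube r x -> forall l, `|P x ord0 l - x ord0 l| <= r / 4,
      forall l, `|c ord0 l| <= r / 4 &
      forall j x t, cube r x -> m x = 0 -> 0 <= t <= 2 -> push P c j x t != 0].
Proof.
have [mu1 mu10 mu1P] := dist_from_a true; have [mu2 mu20 mu2P] := dist_from_a false.
pose mu := Num.min mu1 mu2; have mu0 : 0 < mu by rewrite lt_min mu10 mu20.
have muP j x : cube r x -> m x = 0 -> mu <= l1 (x - a j).
  by case: j => rx mx; rewrite ge_min ?mu1P ?mu2P ?orbT.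
have n0 : 0 < n%:R :> R by rewrite ltr0n (leq_ltn_trans _ In).
(* The second bound makes [P] move points by at most [mu / 2] in the l1 norm. *)
pose eta := Num.min (r / 4) (mu / (2 * n%:R)).
have eta0 : 0 < eta by rewrite lt_min !divr_gt0 ?mulr_gt0.
have [P [M [Pnear PM Pc]]] := @lipschitz_approx R n V psi r eta psi_cont psi_inj r_gt0 eta0.
have l1P x : cube r x -> l1 (P x - x) <= mu / 2.
  move=> rx; apply: (@le_trans _ _ (n%:R * eta)).
    by apply: l1_le => l; rewrite !mxE; exact: Pnear.
  rewrite mulrC -ler_pdivlMr // (_ : mu / 2 / n%:R = mu / (2 * n%:R)).
    by rewrite ge_min lexx orbT.
  by rewrite invfM mulrA.
have P4 x : cube r x -> forall l, `|P x ord0 l - x ord0 l| <= r / 4.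
  by move=> rx l; rewrite (le_trans (Pnear x rx l)) // ge_min lexx.
have [A A0 ctrl] := ctrlZ.
(* Bounds the position [(1 - t)^-1] of [c] on the ray; the 1 covers the coordinates [psi]. *)
pose S := Num.max 1 (n%:R * r / mu).
pose X := {xs : 'rV[R]_n * R | (cube r xs.1 /\ m xs.1 = 0) /\ 0 <= xs.2 <= S}.
pose e (j : bool) (x : X) (i : option {v | v \in I}) :=
  if i is Some v then psi (val v) (projT1 x).1 else (projT1 x).2.
pose Q j (x : X) := a j + (projT1 x).2 *: (P (projT1 x).1 - a j).
have S1 : 1 <= S by rewrite le_max lexx.
have [||j x i|j x x' d d0 xd l|c c4 Pnc] := @lipschitz_image_avoids R n
    (option {v | v \in I}) bool X e Q S (3 * r + S * (M * A)) (r / 4).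
- by rewrite card_option card_sig.
- by rewrite divr_gt0.
- have [_ s0S] := projT2 x; case: i => [v|] //=.
  by have /andP[-> /= /le_trans ->] := psi01 (val v) (projT1 x).1.
- have [[rx mx] s0S] := projT2 x; have [[rx' mx'] s0S'] := projT2 x'.
  have xdI v : v \in I -> `|psi v (projT1 x).1 - psi v (projT1 x').1| <= d.
    by move=> vI; exact: (xd (Some (exist _ v vI))).
  have ss : `|(projT1 x).2 - (projT1 x').2| <= d := xd None.
  rewrite /Q; move: (projT1 x) (projT1 x') rx mx s0S rx' mx' s0S' xdI ss {xd}.
  move=> [{}x s] [{}x' s'] /= rx mx /andP[s0 sS] rx' mx' /andP[s0' sS'] xdI ss.
  have PP : `|P x ord0 l - P x' ord0 l| <= M * (A * d).
    by apply: PM; [rewrite mulr_ge0|exact: ctrl].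
  rewrite !mxE opprD addrACA subrr add0r.
  have -> : s * (P x ord0 l - a j ord0 l) - s' * (P x' ord0 l - a j ord0 l) =
     (s - s') * (P x ord0 l - a j ord0 l) + s' * (P x ord0 l - P x' ord0 l) by ring.
  rewrite (le_trans (ler_normD _ _)) // !normrM mulrDl lerD //.
    rewrite mulrC ler_pM //.
    have := r_gt0; have := P4 x rx l; have := rx l; have := a_small j l; rewrite !ler_norml.
    by move=> /andP[? ?] /andP[? ?] /andP[? ?] ?; apply/andP; split; lra.
  by rewrite -mulrA -mulrA ger0_norm // ler_pM.
exists P, c; split=> // j x t rx mx /andP[t0 t2].
have xa := muP j x rx mx; have xP := l1P x rx.
rewrite /push; have [t1|t1] := leP t 1; last first.
  apply/eqP => h.
  have tt : 0 <= 2 - t <= 1 by apply/andP; split; lra.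
  have E : x - a j = (t - 2) *: (P x - x).
    apply/eqP; rewrite -subr_eq0 -h max_r ?subr_ge0 ?ltW //; apply/eqP/rowP => l.
    by rewrite !mxE; ring.
  have := xa; rewrite E l1Z distrC ger0_norm; last by case/andP: tt.
  have := mu0; have : 0 <= l1 (P x - x) by exact: sumr_ge0.
  by case/andP: tt => *; nra.
apply/eqP => h.
have E : P x - a j = (1 - t) *: (c - a j).
  apply/eqP; rewrite -subr_eq0 -h max_l ?subr_le0 //; apply/eqP/rowP => l.
  by rewrite !mxE; ring.
have aP : mu / 2 <= l1 (P x - a j).
  have := l1D (P x - a j) (x - P x); rewrite addrC subrKA -(opprB (P x)) l1N; lra.
have ca : l1 (c - a j) <= n%:R * (r / 2).
  apply: l1_le => l; rewrite !mxE; have := r_gt0; have := c4 l; have := a_small j l.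
  rewrite !ler_norml => /andP[? ?] /andP[? ?] ?; apply/andP; split; lra.
have u0 : 0 < 1 - t.
  rewrite lt_neqAle subr_ge0 t1 andbT; apply/negP => /eqP u0.
  by move: aP; rewrite E -u0 scale0r /l1 big1 => [|l _]; [lra|rewrite mxE normr0].
have uS : 0 <= (1 - t)^-1 <= S.
  rewrite invr_ge0 (ltW u0) /= le_max; apply/orP; right.
  rewrite -[leLHS]mul1r ler_pdivrMr // mulrAC ler_pdivlMr // mul1r.
  move: aP; rewrite E l1Z (gtr0_norm u0) => aP.
  have : (1 - t) * l1 (c - a j) <= (1 - t) * (n%:R * (r / 2)) by rewrite ler_pM2l.
  lra.
apply: (Pnc j (exist _ (x, (1 - t)^-1) (conj (conj rx mx) uS))).
by rewrite /Q /= E scalerA mulVf ?gt_eqF // scale1r addrC subrK.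
Qed.

(** Glue two pushes: the one for [a false] where [m] is positive and the one for [a true] elsewhere,
    with time growing from 0 on the zero set, where both equal [P - c], to 2 away from it. The
    result has no zero but is within [r / 2] of the identity on the cube. *)
Lemma low_dim_no_separation : False.
Proof.
have [P [c [Pc P4 c4 PZ]]] := generic_push.
have near_zero j : exists2 eps, 0 < eps & forall x t, cube r x -> 0 <= t <= 2 ->
    eps <= `|m x| + l1 (push P c j x t).
  have [||[x t] [/= rx t02]|eps eps0 epsP] := @compact_pos_bound R ('rV[R]_n * R)%type
      (cube r `*` `[0, 2]%classic)
      (fun xt : 'rV[R]_n * R => `|m xt.1| + l1 (push P c j xt.1 xt.2)).
  - by apply: compact_setX; [exact: cube_compact|exact: segment_compact].
  - have fc := @cts_fst 'rV[R]_n R; have sc := @cts_snd 'rV[R]_n R.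
    apply: ctsD; first by apply: cts_norm; exact: (cts_comp fc m_cont).
    apply: cts_sum => l; apply: cts_norm.
    have -> : (fun xt => push P c j xt.1 xt.2 ord0 l) = (fun xt => P xt.1 ord0 l +
        Num.max 0 (xt.2 - 1) * (xt.1 ord0 l - P xt.1 ord0 l) - c ord0 l
        - Num.min 1 xt.2 * (a j ord0 l - c ord0 l)).
      by apply/funext => xt; rewrite !mxE.
    have Pl := cts_comp fc (Pc l).
    have xl := cts_comp fc (@coord_continuous _ _ _ ord0 l).
    have k b : continuous (fun _ : 'rV[R]_n * R => b : R) by exact: cts_cst.
    apply: ctsB; last by apply: ctsM => //; apply: cts_min.
    apply: ctsB => //; apply: ctsD => //; apply: ctsM; last exact: ctsB.
    by apply: cts_max => //; apply: ctsB.
  - have [mx|mx] := eqVneq (m x) 0; last by rewrite ltr_pwDl ?normr_gt0 ?l1_ge0.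
    by rewrite mx normr0 add0r l1_gt0 PZ //; move: t02; rewrite /= in_itv.
  - by exists eps => // x t rx t02; apply: (epsP (x, t)); split; rewrite //= in_itv.
have [e1 e10 e1P] := near_zero true; have [e2 e20 e2P] := near_zero false.
pose eps := Num.min e1 e2; have eps0 : 0 < eps by rewrite lt_min e10 e20.
have epsP j x t : cube r x -> 0 <= t <= 2 -> eps <= `|m x| + l1 (push P c j x t).
  by case: j => rx t02; rewrite ge_min ?e1P ?e2P ?orbT.
have epsN0 : eps != 0 by rewrite gt_eqF.
pose tau sg x : R := Num.min 2 (Num.max 0 (sg * (2 / eps * m x))).
have tau02 sg x : 0 <= tau sg x <= 2 by rewrite le_min ler0n le_max lexx ge_min lexx.
have tauN sg x : sg * m x <= 0 -> tau sg x = 0.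
  move=> smx; rewrite /tau mulrCA max_l ?min_r //.
  by rewrite mulr_ge0_le0 // divr_ge0 // ltW.
have tau2 sg x : eps <= sg * m x -> tau sg x = 2.
  move=> smx; rewrite /tau mulrCA min_l // le_max; apply/orP; right.
  by rewrite mulrAC ler_pdivlMr // ler_pM2l.
(* One formula serves both sides, since at least one of the two times [tau] is 0 at each point. *)
pose G l x := P x ord0 l + Num.max 0 (tau 1 x + tau (- 1) x - 1) * (x ord0 l - P x ord0 l)
  - c ord0 l - Num.min 1 (tau 1 x) * (a false ord0 l - c ord0 l)
  - Num.min 1 (tau (- 1) x) * (a true ord0 l - c ord0 l).
have GE x : exists j t, [/\ 0 <= t <= 2, forall l, G l x = push P c j x t ord0 l &
    eps <= `|m x| -> t = 2 /\ x != a j].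
  have [mx|/ltW mx] := leP 0 (m x).
    exists false, (tau 1 x); split=> // [l|].
      rewrite /G (tauN (- 1)) ?mulN1r ?oppr_le0 // addr0 (min_r ler01) mul0r subr0.
      by rewrite !mxE.
    rewrite ger0_norm // => emx; rewrite tau2 ?mul1r //; split=> //.
    by apply: contraTneq ma_false => <-; rewrite -leNgt.
  exists true, (tau (- 1) x); split=> // [l|].
    rewrite /G (tauN 1) ?mul1r // add0r (min_r ler01) mul0r subr0.
    by rewrite !mxE.
  rewrite ler0_norm // => emx; rewrite tau2 ?mulN1r //; split=> //.
  by apply: contraTneq ma_true => <-; rewrite -leNgt.
have Gc l : continuous (G l).
  have k b : continuous (fun _ : 'rV[R]_n => b : R) by exact: cts_cst.
  have tauc sg : continuous (tau sg).
    by apply: cts_min => //; apply: cts_max => //; apply: ctsM => //; apply: ctsM.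
  have xl := @coord_continuous R 1 n ord0 l.
  apply: ctsB; last by apply: ctsM => //; apply: cts_min.
  apply: ctsB; last by apply: ctsM => //; apply: cts_min.
  apply: ctsB => //; apply: ctsD; first exact: Pc.
  apply: ctsM; last by apply: ctsB => //; exact: Pc.
  by apply: cts_max => //; apply: ctsB => //; apply: ctsD.
have Gnear l x : cube r x -> `|G l x - x ord0 l| <= r / 2.
  move=> rx; have [j [t [/andP[t0 t2] -> _]]] := GE x; rewrite !mxE.
  have := r_gt0; have := P4 x rx l; have := c4 l; have := a_small j l.
  rewrite !ler_norml; move: (P x ord0 l) (x ord0 l) (a j ord0 l) (c ord0 l) => p y u v.
  have : 0 <= Num.min 1 t <= 1 by rewrite le_min ler01 t0 ge_min lexx.
  have : 0 <= Num.max 0 (t - 1) <= 1.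
    by rewrite le_max lexx ge_max ler01 /=; lra.
  move: (Num.min _ _) (Num.max _ _) => f g.
  move=> /andP[? ?] /andP[? ?] /andP[? ?] /andP[? ?] /andP[? ?] ?.
  by apply/andP; split; nra.
have [//|l x rx xl|l x rx xl|x rx Gx] := @poincare_miranda R n r G r_gt0.
- have := r_gt0; have := Gnear l x rx; rewrite ler_norml xl => /andP[? ?] ?; lra.
- have := r_gt0; have := Gnear l x rx; rewrite ler_norml xl => /andP[? ?] ?; lra.
(* By the choice of [eps], a zero has [m] of absolute value at least [eps]; there [push] is
   [x - a j], and the sign of [m] excludes [x = a j]. *)
have [j [t [t02 GxE far]]] := GE x.
have push0 : push P c j x t = 0 by apply/rowP => l; rewrite -GxE Gx mxE.
have := epsP j x t rx t02; rewrite push0 (_ : l1 0 = 0) ?addr0; last first.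
  by rewrite /l1 big1 // => l _; rewrite mxE normr0.
move=> /far[t2 /eqP xa]; apply: xa; apply/eqP; rewrite -subr_eq0 -push0 t2.
apply/eqP/rowP => l; rewrite !mxE.
have -> : Num.max 0 (2 - 1) = 1 :> R by rewrite max_r; lra.
by have -> : Num.min 1 2 = 1 :> R; [rewrite min_l; lra|ring].
Qed.
End Separation.
End LowDimensional.

(** * Links in triangulated spheres *)

Lemma continuous_to_row (R : realType) (T : topologicalType) n (f : T -> 'rV[R]_n) :
  (forall l, continuous (fun x => f x ord0 l)) -> continuous f.
Proof.
move=> fc x A [P Px PA].
suff : \forall y \near x, forall l, P ord0 l (f y ord0 l).
  by apply: filterS => y yP; apply: PA => i j; rewrite (ord1 i).
by apply: filter_forall => l; apply: (fc l x); exact: Px.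
Qed.

Lemma continuous_to_set_type (T U : topologicalType) (A : set U) (f : T -> set_type A) :
  continuous (fun x => set_val (f x)) -> continuous f.
Proof. by move=> fc; apply: (@continuous_comp_initial _ _ _ set_val). Qed.

Lemma set_val_cts (U : topologicalType) (A : set U) : continuous (@set_val U A).
Proof. exact: initial_continuous. Qed.

Lemma cts_inv (R : realType) (T : topologicalType) (f : T -> R) :
  (forall x, f x != 0) -> continuous f -> continuous (fun x => (f x)^-1).
Proof. by move=> f0 fc x; apply: cvgV; [exact: f0|exact: fc]. Qed.

(** * A chart of the sphere by central projection *)

Section SphereChart.
Variables (R : realType) (n : nat) (s : set_type (sphere R n)) (m : 'I_n.+1).
Hypothesis sm0 : set_val s ord0 m != 0.

Let lifted (y : 'rV[R]_n) (j : 'I_n.+1) : R :=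
  set_val s ord0 j + (if unlift m j is Some k then y ord0 k else 0).
Let sqnorm (y : 'rV[R]_n) : R := \sum_j lifted y j ^+ 2.

Lemma lifted_m y : lifted y m = set_val s ord0 m.
Proof. by rewrite /lifted unlift_none addr0. Qed.

Lemma sqnorm_gt0 y : 0 < sqnorm y.
Proof.
rewrite /sqnorm (bigD1 m) //= ltr_pwDl ?sumr_ge0 // => [|j _]; last exact: sqr_ge0.
by rewrite lifted_m exprn_even_gt0.
Qed.

Let center_row (y : 'rV[R]_n) : 'rV[R]_n.+1 := \row_j (lifted y j / Num.sqrt (sqnorm y)).

Lemma center_row_sphere y : center_row y \in sphere R n.
Proof.
apply/mem_set; rewrite /sphere /=.
under eq_bigr do rewrite mxE exprMn exprVn sqr_sqrtr ?(ltW (sqnorm_gt0 y)) //.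
by rewrite -mulr_suml divff // gt_eqF ?sqnorm_gt0.
Qed.

(* Central projection of an affine hyperplane through [s] onto a hemisphere. *)
Definition sphere_chart (y : 'rV[R]_n) : set_type (sphere R n) := 
  exist (fun x => x \in sphere R n) _ (center_row_sphere y).

Lemma lifted_cts j : continuous (fun y => lifted y j).
Proof.
apply: ctsD; first exact: cts_cst.
by case: unlift => [k|]; [exact: coord_continuous|exact: cts_cst].
Qed.

Lemma sphere_chart_cts : continuous sphere_chart.
Proof.
apply: continuous_to_set_type; apply: continuous_to_row => j.
have -> : (fun y => set_val (sphere_chart y) ord0 j) =
    (fun y => lifted y j * (Num.sqrt (sqnorm y))^-1).
  by apply/funext => y; rewrite set_valE /= mxE.
apply: ctsM; first exact: lifted_cts.
apply: cts_inv => [y|]; first by rewrite gt_eqF // sqrtr_gt0 sqnorm_gt0.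
apply: (@cts_comp _ _ _ sqnorm Num.sqrt); last exact: sqrt_continuous.
by apply: cts_sum => i; apply: ctsM; exact: lifted_cts.
Qed.

(** Coordinate [m] of [lifted y] does not depend on [y], so the image determines the normalizing
    factor. *)
Lemma sphere_chart_inj : injective sphere_chart.
Proof.
move=> y z /(congr1 val) /= yz.
have yzj j : lifted y j / Num.sqrt (sqnorm y) = lifted z j / Num.sqrt (sqnorm z).
  by have := congr1 (fun x : 'rV[R]_n.+1 => x ord0 j) yz; rewrite !mxE.
have sq : Num.sqrt (sqnorm y) = Num.sqrt (sqnorm z).
  by have := yzj m; rewrite !lifted_m => /(mulfI sm0) /invr_inj.
apply/rowP => k; have := yzj (lift m k); rewrite sq => /mulIf h.
have {}h : lifted y (lift m k) = lifted z (lift m k).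
  by apply: h; rewrite invr_eq0 gt_eqF // sqrtr_gt0 sqnorm_gt0.
by move: h; rewrite /lifted liftK => /addrI.
Qed.

Lemma sphere_chart0 : sphere_chart 0 = s.
Proof.
apply: val_inj; apply/rowP => j; rewrite /= mxE.
have E i : lifted 0 i = set_val s ord0 i.
  by rewrite /lifted; case: unlift => [k|]; rewrite ?mxE addr0.
rewrite /sqnorm E; under eq_bigr do rewrite E.
have -> : \sum_i set_val s ord0 i ^+ 2 = 1 by exact: (set_valP s).
by rewrite sqrtr1 divr1.
Qed.

Lemma sphere_chart_onto (s' : set_type (sphere R n)) : 0 < set_val s' ord0 m / set_val s ord0 m ->
  sphere_chart (\row_k (set_val s' ord0 (lift m k) * (set_val s ord0 m / set_val s' ord0 m)
    - set_val s ord0 (lift m k))) = s'.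
Proof.
move=> ss; set q := _ / set_val s' ord0 m; set y := \row__ _.
have s'm : set_val s' ord0 m != 0 by apply: contraTneq ss => ->; rewrite mul0r ltxx.
have q0 : 0 < q by rewrite /q -invf_div invr_gt0.
have E j : lifted y j = set_val s' ord0 j * q.
  rewrite /lifted; case: (unliftP m j) => [k ->|->]; first by rewrite mxE addrC subrK.
  by rewrite addr0 /q mulrCA divff // mulr1.
have sq : Num.sqrt (sqnorm y) = q.
  rewrite /sqnorm; under eq_bigr do rewrite E exprMn.
  rewrite -mulr_suml (_ : \sum_i _ = 1) ?mul1r; last exact: (set_valP s').
  by rewrite sqrtr_sqr gtr0_norm.
by apply: val_inj; apply/rowP => j; rewrite /= mxE sq E mulfK // gt_eqF.
Qed.

Let crd (j : 'I_n.+1) (x : set_type (sphere R n)) : R := set_val x ord0 j.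

(** The explicit inverse from [sphere_chart_onto] is continuous at [s], with value 0 there. *)
Lemma sphere_chart_open (e : R) : 0 < e -> \forall x \near s,
  exists2 y : 'rV[R]_n, forall l, `|y ord0 l| < e & sphere_chart y = x.
Proof.
move=> e0.
have cc j : continuous (crd j).
  exact: (cts_comp (@set_val_cts _ _) (@coord_continuous _ _ _ ord0 j)).
have near_pos : \forall x \near s, 0 < crd m x / crd m s.
  have ss0 : 0 < crd m s / crd m s by rewrite divff.
  exact: cvgr_gt (@ctsM _ _ _ _ (cc m) (@cts_cst _ _ (crd m s)^-1) s) _ ss0.
pose dev k x := `|crd (lift m k) x * (crd m s / crd m x) - crd (lift m k) s|.
have near_small : \forall x \near s, forall k, dev k x < e.
  apply: (@filter_forall _ _ (fun k => [set x | dev k x < e]) (nbhs s) (nbhs_filter s)) => k.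
  have cv : {for s, continuous (fun x => (crd m x)^-1)} by exact: (@cvgV R _ (nbhs s) (nbhs_filter s) (crd m) (crd m s) sm0 (cc m s)).
  have cst c : {for s, continuous (fun _ : set_type (sphere R n) => c : R)} by exact: cts_cst.
  have cd : {for s, continuous (dev k)}.
    apply: (@continuous_comp _ _ _ _ (@Num.norm R R)); last exact: norm_continuous.
    exact: (continuousB (continuousM (cc _ s) (continuousM (cst _) cv)) (cst _)).
  suff ds : dev k s < e by exact: cvgr_lt cd _ ds.
  by rewrite /dev divff // mulr1 subrr normr0.
near=> x; eexists; last by apply: sphere_chart_onto; near: x.
by move=> l; rewrite mxE; move: l; near: x.
Unshelve. all: by end_near. Qed.

End SphereChart.

(** The filter of sup-norm balls converges to [x] in each coordinate, hence in the product
    topology. *)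
Lemma ptws_nbhs (R : realType) (V : finType) (x : {ptws V -> R}) (A : set {ptws V -> R}) :
  nbhs x A -> exists2 d, 0 < d & forall y : {ptws V -> R}, (forall v, `|x v - y v| < d) -> A y.
Proof.
pose F : set_system {ptws V -> R} :=
  filter_from [set d : R | 0 < d] (fun d => [set y | forall v, `|x v - y v| < d]).
have FF : Filter F.
  apply: filter_from_filter; first by exists 1 => /=.
  move=> d d' /= d0 d0'; exists (Num.min d d'); first by rewrite /= lt_min d0 d0'.
  by move=> y /= xy; split=> v; have := xy v; rewrite lt_min => /andP[].
suff : F --> x by move=> /[apply] -[d d0 dA]; exists d.
apply/cvg_sup => v; apply/cvg_image.
  by rewrite eqEsubset; split=> // c _; exists (fun _ => c).
move=> B /nbhs_ballP[e /= e0 eB].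
exists [set y : {ptws V -> R} | B (y v)].
  by exists e => // y /= xy; apply: eB; exact: xy.
rewrite eqEsubset; split=> [_ [y /= By <-] //|c Bc].
by exists (fun _ => c).
Qed.

(** * Charts of the realization around a face, purity and links *)

Section Triangulation.
Variables (R : realType) (n : nat) (V : finType) (K : {set {set V}}).
Hypothesis Ktri : sphere_triangulation R n K.

(** [psi] gives the barycentric coordinates in a chart of the sphere. The last clause says that
    small balls of the chart cover neighborhoods of [x0] in the realization. *)
Lemma realization_chart (x0 : {ptws V -> R}) : realization R K x0 ->
  exists psi : V -> 'rV[R]_n -> R,
  [/\ forall v, continuous (psi v),
      forall y, realization R K (fun v => psi v y),
      forall y z, (forall v, psi v y = psi v z) -> y = z,
      forall v, psi v 0 = x0 v &
      forall e, 0 < e -> exists2 d, 0 < d & forall x : {ptws V -> R}, realization R K x ->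
        (forall v, `|x0 v - x v| < d) ->
        exists2 y : 'rV[R]_n, forall l, `|y ord0 l| < e & forall v, psi v y = x v].
Proof.
move=> Kx0; have [_ [f [g [fc gc fK gK]]]] := Ktri.
pose x0s : set_type (realization R K) := exist (fun x => x \in realization R K) x0 (mem_set Kx0).
have [m sm0] : exists m, set_val (f x0s) ord0 m != 0.
  apply: contrapT => /forallNP sm; have := set_valP (f x0s); rewrite /sphere /=.
  rewrite big1 => [/esym/eqP|j _]; first by rewrite oner_eq0.
  by have /negP := sm j; rewrite negbK => /eqP ->; rewrite expr0n.
pose h y := g (sphere_chart sm0 y).
have hc : continuous h by apply: (cts_comp _ gc); exact: sphere_chart_cts.
exists (fun v y => (set_val (h y) : {ptws V -> R}) v); split=> [v|y|y z yz|v|e e0].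
- exact: (cts_comp (cts_comp hc (@set_val_cts _ _)) (@proj_continuous V (fun _ => R) v)).
- exact: (set_valP (h y)).
- apply: (sphere_chart_inj (sm0 := sm0)); apply: (can_inj gK).
  by apply: val_inj; apply/funext.
- by rewrite /h sphere_chart0 fK.
- have := sphere_chart_open sm0 e0 => /(fc x0s).
  move=> [W [[W' oW' <-] /= Wx0 WU]].
  have [d d0 dW] : exists2 d, 0 < d & forall y : {ptws V -> R},
      (forall v, `|x0 v - y v| < d) -> W' y.
    by apply: ptws_nbhs; exact: open_nbhs_nbhs.
  exists d => // x Kx x0x; pose xs : set_type (realization R K) :=
    exist (fun x => x \in realization R K) x (mem_set Kx).
  have [y ye yx] := WU xs (dW x x0x).
  by exists y => // v; rewrite /h yx fK.
Qed.

Definition supp (x : V -> R) : {set V} := [set v | x v != 0]%SET.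

Lemma realization_supp (x : V -> R) : realization R K x -> supp x \in K.
Proof. by case. Qed.

Lemma realization01 (x : V -> R) v : realization R K x -> 0 <= x v <= 1.
Proof.
case=> x0 x1 _; rewrite x0 /= -x1 (bigD1 v) //= lerDl.
by apply: sumr_ge0 => i _; exact: x0.
Qed.

Lemma face_sub (s t : {set V}) : s \in K -> t \subset s -> t != finset.set0 -> t \in K.
Proof. by have [[_ _ Ksub] _] := Ktri; exact: Ksub. Qed.

Lemma face_neq0 (s : {set V}) : s \in K -> s != finset.set0.
Proof. by have [[K0 _ _] _] := Ktri; move=> sK; apply: contraTneq sK => ->. Qed.

Definition barycenter (s : {set V}) (v : V) : R := (v \in s)%:R / #|s|%:R.

Section Face.
Variable s : {set V}.
Hypothesis sK : s \in K.

Lemma card_face_gt0 : 0 < #|s|%:R :> R.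
Proof. by rewrite ltr0n card_gt0 face_neq0. Qed.

Lemma sum_barycenter : \sum_v barycenter s v = 1.
Proof.
rewrite -mulr_suml (_ : \sum_v (v \in s)%:R = #|s|%:R) ?divff ?gt_eqF ?card_face_gt0 //.
by rewrite -sum1_card natr_sum [RHS]big_mkcond /=; apply: eq_bigr => v _; case: (v \in s).
Qed.

Lemma barycenter_ge0 v : 0 <= barycenter s v.
Proof. by rewrite divr_ge0. Qed.

Lemma barycenter_gt0 v : (0 < barycenter s v) = (v \in s).
Proof. by rewrite /barycenter pmulr_lgt0 ?invr_gt0 ?card_face_gt0 // ltr0n lt0b. Qed.

Lemma barycenter_realization : realization R K (barycenter s).
Proof.
split=> [v||]; [exact: barycenter_ge0|exact: sum_barycenter|].
suff -> : finset (fun v => barycenter s v != 0) = s by [].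
by apply/setP => v; rewrite inE -barycenter_gt0 lt_neqAle barycenter_ge0 andbT eq_sym.
Qed.

Definition shifted (w : V) (th : R) (v : V) : R :=
  (1 - th) * barycenter s v + th * (v == w)%:R.

Lemma shifted_realization w th : 0 < th < 1 -> (w |: s)%SET \in K ->
  realization R K (shifted w th).
Proof.
move=> /andP[th0 th1] wsK.
have sh0 v : 0 <= shifted w th v.
  by rewrite addr_ge0 ?mulr_ge0 ?barycenter_ge0 ?subr_ge0 // ltW.
split=> [v||]; first exact: sh0.
  rewrite big_split -!mulr_sumr sum_barycenter (bigD1 w) //= eqxx big1 ?addr0; last first.
    by move=> i /negPf ->.
  by rewrite !mulr1 subrK.
suff -> : finset (fun v => shifted w th v != 0) = (w |: s)%SET by [].
apply/setP => v; rewrite !inE; have := sh0 v; rewrite le_eqVlt eq_sym => /orP[/eqP h|h].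
  rewrite h eqxx; move/eqP: h.
  rewrite paddr_eq0 ?mulr_ge0 ?barycenter_ge0 ?subr_ge0 ?(ltW th0) ?(ltW th1) //.
  rewrite [_ * barycenter s v == 0]mulf_eq0 [th * _ == 0]mulf_eq0.
  rewrite subr_eq0 (gt_eqF th1) (gt_eqF th0) /= => /andP[b0].
  case: (v =P w) => [_|_ _] /=; first by rewrite pnatr_eq0.
  by rewrite -barycenter_gt0 (eqP b0) ltxx.
rewrite gt_eqF //; apply/esym; move: h; rewrite /shifted; case: eqP => //= _.
by rewrite mulr0 addr0 pmulr_rgt0 ?subr_gt0 // barycenter_gt0.
Qed.

Lemma shifted_near w th v : 0 <= th -> `|barycenter s v - shifted w th v| <= th.
Proof.
move=> th0; rewrite /shifted (_ : _ - _ = th * (barycenter s v - (v == w)%:R)); last by ring.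
have /andP[b0 b1] := realization01 v barycenter_realization.
rewrite normrM (ger0_norm th0) ler_piMr // ler_norml.
by case: (v == w); apply/andP; split; rewrite ?mulr1n ?mulr0n; lra.
Qed.

(** Near the barycenter the weights on [s] stay positive, so a small cube lies in the open star of
    [s]. Points shifted slightly towards link vertices fall near its center. *)
Lemma face_chart : exists (psi : V -> 'rV[R]_n -> R) (r : R),
  [/\ [/\ 0 < r, forall v, continuous (psi v), forall y, realization R K (fun v => psi v y) &
          forall y z, (forall v, psi v y = psi v z) -> y = z],
      forall y v, cube r y -> v \in s -> 0 < psi v y &
      forall w, (w |: s)%SET \in K -> exists (y : 'rV[R]_n) th,
        [/\ 0 < th < 1, forall l, `|y ord0 l| <= r / 4 & forall v, psi v y = shifted w th v]].
Proof.
have [psi [psic psiK psi_inj psi0 psi_open]] := realization_chart barycenter_realization.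
have : \forall y \near (0 : 'rV[R]_n), forall v, v \in s -> 0 < psi v y.
  apply: (@filter_forall _ _ (fun v => [set y | v \in s -> 0 < psi v y]) _ (nbhs_filter _)) => v.
  have [vs|vs] := boolP (v \in s); last by apply: nearW.
  have p0 : 0 < psi v 0 by rewrite psi0 barycenter_gt0.
  have : \forall y \near (0 : 'rV[R]_n), 0 < psi v y by exact: cvgr_gt (psic v 0) _ p0.
  by apply: filterS => y /= py _.
move=> /near_rowP[e e0 eP]; have e20 : 0 < e / 2 by rewrite divr_gt0.
exists psi, (e / 2); split=> //.
  move=> y v ry; apply: eP => l; rewrite mxE sub0r normrN (le_lt_trans (ry l)) //.
  by rewrite ltr_pdivrMr // ltr_pMr // ltr1n.
have [|d d0 dP w wsK] := psi_open (e / 2 / 4); first by rewrite divr_gt0.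
have th0 : 0 < Num.min (d / 2) (1 / 2) by rewrite lt_min !divr_gt0.
have th1 : Num.min (d / 2) (1 / 2) < 1 by rewrite gt_min; apply/orP; right; lra.
have thd : Num.min (d / 2) (1 / 2) < d by rewrite gt_min; apply/orP; left; lra.
move: (Num.min _ _) th0 th1 thd => th th0 th1 thd.
have th01 : 0 < th < 1 by rewrite th0.
have [v|y ye yP] := dP _ (shifted_realization th01 wsK).
  by rewrite (le_lt_trans (shifted_near _ _ (ltW th0))).
by exists y, th; split=> // l; exact: ltW.
Qed.

(** The weights off [s] vanish, and the one at [v0] is 1 minus the sum of the others. *)
Lemma controlled_face (psi : V -> 'rV[R]_n -> R) (Z : set 'rV[R]_n) v0 :
  v0 \in s -> (forall y, realization R K (fun v => psi v y)) ->
  (forall y v, Z y -> v \notin s -> psi v y = 0) -> controlled psi (s :\ v0)%SET Z.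
Proof.
move=> v0s psiK psiZ; exists (#|V|.+1)%:R => // x x' d Zx Zx' d0 xd.
have d_le : d <= #|V|.+1%:R * d by rewrite ler_peMl // ler1n.
move=> v; have [vs|vs] := boolP (v \in s); last by rewrite !psiZ // subrr normr0 mulr_ge0.
have [->|vv0] := eqVneq v v0; last by rewrite (le_trans _ d_le) // xd // !inE vv0.
have E y : psi v0 y = 1 - \sum_(v | v != v0) psi v y.
  by have [_ <- _] := psiK y; rewrite (bigD1 v0) //= addrK.
rewrite !E opprB addrC addrA subrK -sumrB (le_trans (ler_norm_sum _ _ _)) //.
apply: (@le_trans _ _ (\sum_(v : V) d)).
  rewrite big_mkcond ler_sum // => i _; case: eqP => //= /eqP iv0.
  have [iS|iS] := boolP (i \in s); first by rewrite distrC xd // !inE iv0.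
  by rewrite !psiZ // subrr normr0.
by rewrite sumr_const -[leLHS]mulr_natl ler_wpM2r // ler_nat leqW.
Qed.

End Face.

(** If [s] were maximal, the chart cube at its barycenter would be supported in [s], hence
    controlled by [#|s|.-1 < n] coordinates. *)
Lemma face_extends (s : {set V}) : s \in K -> (#|s| <= n)%N ->
  exists2 v, v \notin s & (v |: s)%SET \in K.
Proof.
move=> sK sn; apply: contrapT => noext.
have smax t : t \in K -> s \subset t -> t = s.
  move=> tK st; apply/eqP; rewrite eq_sym finset.eqEsubset st /=; apply/fintype.subsetP => v vt.
  apply/negPn/negP => vs; apply: noext; exists v => //.
  apply: face_sub tK _ _; first by rewrite finset.subUset finset.sub1set vt.
  by apply/set0Pn; exists v; rewrite !inE eqxx.
have [v0 v0s] := set0Pn _ (face_neq0 sK).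
have [psi [r [[r0 psic psiK psi_inj] psi_pos _]]] := face_chart sK.
have := @no_low_dim_chart R n V psi r psic (fun v y => realization01 v (psiK y))
  (fun y z _ _ => @psi_inj y z) r0 (s :\ v0)%SET; apply.
  by rewrite (cardsD1 v0) v0s in sn.
apply: controlled_face => // y v ry vs.
have := smax _ (realization_supp (psiK y)).
move=> /(_ _)/setP/(_ v); rewrite inE (negPf vs) => h.
apply/eqP/negbFE; apply: h; apply/fintype.subsetP => w ws.
by rewrite inE gt_eqF // psi_pos.
Qed.

(** Compare the weight on the component [L] of [u] with the weight on the other vertices off [s]. No
    point of the cube carries both, so the difference [m] vanishes only on the face [s], a set too
    small to separate. *)
Lemma link_connected (s : {set V}) u w : s \in K -> (#|s| < n)%N ->
  u \notin s -> w \notin s -> (u |: s)%SET \in K -> (w |: s)%SET \in K ->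
  connect (link_rel K s) u w.
Proof.
move=> sK sn us ws usK wsK; apply/negPn/negP => uw.
pose L := [set v | connect (link_rel K s) u v]%SET.
have [v0 v0s] := set0Pn _ (face_neq0 sK).
have [psi [r [[r0 psic psiK psi_inj] psi_pos shift]]] := face_chart sK.
pose m y := \sum_(v | (v \notin s) && (v \in L)) psi v y -
            \sum_(v | (v \notin s) && (v \notin L)) psi v y.
have [a1 [t1 [/andP[t10 t11] a1r a1E]]] := shift u usK.
have [a2 [t2 [/andP[t20 t21] a2r a2E]]] := shift w wsK.
have sh_out x t v : v \notin s -> shifted s x t v = t * (v == x)%:R.
  by move=> vs; rewrite /shifted /barycenter (negPf vs) mul0r mulr0 add0r.
have psi_ge0 v y : 0 <= psi v y by have [h _ _] := psiK y; exact: h.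
(* Two vertices off [s] with positive weight at [y] span a face together with [s], so they are
   adjacent in the link. *)
have sep x y v : v \notin s -> x \notin s -> v \in L -> x \notin L -> cube r y ->
    psi v y = 0 \/ psi x y = 0.
  move=> vs xs vL xL ry; have [->|/eqP v0'] := eqVneq (psi v y) 0; first by left.
  right; apply/eqP; apply: contraNT xL => x0'; move: vL; rewrite !inE => vL.
  apply: (connect_trans vL); apply: connect1; rewrite /link_rel vs xs /=.
  apply: face_sub (realization_supp (psiK y)) _ _; last first.
    by apply/set0Pn; exists v; rewrite !inE eqxx.
  apply/fintype.subsetP => z; rewrite !inE => /or3P[/eqP ->|/eqP -> //|zs]; first exact/eqP.
  by rewrite gt_eqF // psi_pos.
have := @low_dim_no_separation R n V psi r psic (fun v y => realization01 v (psiK y))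
  (fun y z _ _ => @psi_inj y z) r0 m (fun j : bool => if j then a1 else a2) (s :\ v0)%SET.
apply.
- by apply: ctsB; apply: cts_sum.
- by case.
- have uL : u \in L by rewrite inE connect0.
  rewrite /m (bigD1 u) ?us //= big1 => [|v /andP[/andP[vs _] vu]]; last first.
    by rewrite a1E sh_out // (negPf vu) mulr0.
  rewrite big1 => [|v /andP[vs vL]]; last first.
    by rewrite a1E sh_out // (_ : v == u = false) ?mulr0 //; apply: contraNF vL => /eqP ->.
  by rewrite a1E sh_out // eqxx mulr1 addr0 subr0.
- have wL : w \notin L by rewrite inE.
  rewrite /m big1 => [|v /andP[vs vL]]; last first.
    by rewrite a2E sh_out // (_ : v == w = false) ?mulr0 //; apply: contraTF vL => /eqP ->.
  rewrite (bigD1 w) ?ws //= big1 => [|v /andP[/andP[vs _] vu]]; last first.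
    by rewrite a2E sh_out // (negPf vu) mulr0.
  by rewrite a2E sh_out // eqxx mulr1 addr0 sub0r oppr_lt0.
- by rewrite (cardsD1 v0) v0s in sn.
apply: controlled_face => // y v [ry my] vs.
move: my; rewrite /m => /eqP; rewrite subr_eq0 => /eqP my.
have [vL|vL] := boolP (v \in L).
  have [//|vn0] := eqVneq (psi v y) 0.
  move: my; rewrite [RHS]big1 => [/eqP|x /andP[xs xL]]; last first.
    by have [h|//] := sep x y v vs xs vL xL ry; rewrite h eqxx in vn0.
  rewrite psumr_eq0 // => /allP/(_ v (mem_index_enum v)).
  by rewrite /= vs vL => /eqP.
have [//|vn0] := eqVneq (psi v y) 0.
move: my; rewrite big1 => [/esym/eqP|x /andP[xs xL]]; last first.
  by have [//|h] := sep v y x xs vs xL vL ry; rewrite h eqxx in vn0.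
rewrite psumr_eq0 // => /allP/(_ v (mem_index_enum v)).
by rewrite /= vs vL => /eqP.
Qed.

End Triangulation.

(** * Connectedness of the sphere and of the 1-skeleton *)

Section SphereConnected.
Variables (R : realType) (n : nat).
Hypothesis n_gt0 : (0 < n)%N.
Variable h : set_type (sphere R n) -> R.
Hypotheses (h_cont : continuous h) (h01 : forall x, h x = 0 \/ h x = 1).

(** The segment between the points avoids the origin and normalizes to an arc, along which the
    intermediate value theorem forbids a jump. *)
Lemma two_valued_constant_on_arc (x y : set_type (sphere R n)) :
  set_val x != - set_val y -> h x = h y.
Proof.
move=> xy; pose v (t : R) j := (1 - t) * set_val x ord0 j + t * set_val y ord0 j.
pose N t := \sum_j v t j ^+ 2.
have xx : \sum_j set_val x ord0 j ^+ 2 = 1 by exact: (set_valP x).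
have yy : \sum_j set_val y ord0 j ^+ 2 = 1 by exact: (set_valP y).
have Npos t : 0 < N t.
  have N0 : 0 <= N t by apply: sumr_ge0 => j _; exact: sqr_ge0.
  rewrite lt_neqAle N0 andbT eq_sym; apply/negP => /eqP Nt.
  have vt j : v t j = 0.
    apply/eqP; rewrite -sqrf_eq0; move/eqP: Nt.
    rewrite psumr_eq0 => [/allP/(_ j (mem_index_enum j)) //|i _]; exact: sqr_ge0.
  have E : (1 - t) ^+ 2 = t ^+ 2.
    suff : (1 - t) ^+ 2 * (\sum_j set_val x ord0 j ^+ 2) =
        t ^+ 2 * (\sum_j set_val y ord0 j ^+ 2) by rewrite xx yy !mulr1.
    rewrite !mulr_sumr; apply: eq_bigr => j _; rewrite -!exprMn.
    suff -> : (1 - t) * set_val x ord0 j = - (t * set_val y ord0 j) by rewrite sqrrN.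
    by apply/eqP; rewrite -addr_eq0; apply/eqP; exact: vt.
  have t12 : t = 1 / 2.
    have : 1 - 2 * t = (1 - t) ^+ 2 - t ^+ 2 by ring.
    rewrite E subrr; lra.
  move/eqP: xy; apply; apply/rowP => j; rewrite mxE; have := vt j; rewrite /v t12; lra.
pose arc_row t : 'rV[R]_n.+1 := \row_j (v t j / Num.sqrt (N t)).
have arcP t : arc_row t \in sphere R n.
  apply/mem_set; rewrite /sphere /=.
  under eq_bigr do rewrite mxE exprMn exprVn sqr_sqrtr ?(ltW (Npos t)) //.
  by rewrite -mulr_suml divff //; exact: (lt0r_neq0 (Npos t)).
pose arc t : set_type (sphere R n) := exist (fun x => x \in sphere R n) _ (arcP t).
have vc j : continuous (fun t => v t j).
  have tc : continuous (fun t : R => t) by move=> t; exact: cvg_id.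
  by apply: ctsD; apply: ctsM => //; try exact: cts_cst; apply: ctsB => //; exact: cts_cst.
have arcc : continuous arc.
  apply: continuous_to_set_type; apply: continuous_to_row => j.
  have -> : (fun t => set_val (arc t) ord0 j) = (fun t => v t j * (Num.sqrt (N t))^-1).
    by apply/funext => t; rewrite set_valE /= mxE.
  apply: ctsM; first exact: vc.
  apply: cts_inv => [t|]; first by rewrite gt_eqF // sqrtr_gt0.
  apply: (@cts_comp _ _ _ N Num.sqrt); last exact: sqrt_continuous.
  by apply: cts_sum => i; apply: ctsM; exact: vc.
have arc0 : arc 0 = x.
  apply: val_inj; apply/rowP => j; rewrite /= mxE /N.
  have v0 i : v 0 i = set_val x ord0 i by rewrite /v; ring.
  by under eq_bigr do rewrite v0; rewrite xx v0 sqrtr1 divr1.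
have arc1 : arc 1 = y.
  apply: val_inj; apply/rowP => j; rewrite /= mxE /N.
  have v1 i : v 1 i = set_val y ord0 i by rewrite /v; ring.
  by under eq_bigr do rewrite v1; rewrite yy v1 sqrtr1 divr1.
have [//|hxy] := eqVneq (h x) (h y).
have hc : {within `[0, 1], continuous (h \o arc)}.
  by apply: continuous_subspaceT; exact: (cts_comp arcc h_cont).
have [|c _ hc12] := @IVT R (h \o arc) 0 1 (1 / 2) ler01 hc.
  rewrite /= arc0 arc1; case: (h01 x) (h01 y) hxy => -> [] ->; rewrite ?eqxx // => _.
    by rewrite ge_min le_max; apply/andP; split; apply/orP; [left|right]; lra.
  by rewrite ge_min le_max; apply/andP; split; apply/orP; [right|left]; lra.
by move: hc12 => /=; case: (h01 (arc c)) => ->; lra.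
Qed.

Lemma two_valued_constant (x y : set_type (sphere R n)) : h x = h y.
Proof.
have [xy|] := eqVneq (set_val x) (- set_val y); last exact: two_valued_constant_on_arc.
have xx : \sum_j set_val x ord0 j ^+ 2 = 1 by exact: (set_valP x).
have [m xm0] : exists m, set_val x ord0 m != 0.
  apply: contrapT => /forallNP xm; move: xx.
  rewrite big1 => [/esym/eqP|j _]; first by rewrite oner_eq0.
  by have /negP := xm j; rewrite negbK => /eqP ->; rewrite expr0n.
(* The basis vector at an index [j] other than [m] is antipodal to neither point; such an index
   exists because [n] is positive. *)
pose j : 'I_n.+1 := if m == ord0 then ord_max else ord0.
have jm : m != j.
  by rewrite /j; have [->|//] := eqVneq m ord0; rewrite -val_eqE /= eq_sym -lt0n.
have wP : (delta_mx ord0 j : 'rV[R]_n.+1) \in sphere R n.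
  apply/mem_set; rewrite /sphere /= (bigD1 j) //= big1 => [|i ij]; last first.
    by rewrite mxE (negPf ij) andbF expr0n.
  by rewrite mxE !eqxx expr1n addr0.
pose w : set_type (sphere R n) := exist (fun x => x \in sphere R n) _ wP.
have wm : set_val w ord0 m = 0 by rewrite set_valE /= mxE (negPf jm) andbF.
have ym0 : set_val y ord0 m != 0.
  by rewrite -oppr_eq0; move: xm0; rewrite xy mxE.
transitivity (h w); apply: two_valued_constant_on_arc.
  by apply: contraNneq xm0 => ->; rewrite mxE wm oppr0.
by apply: contraNneq ym0 => E; rewrite -oppr_eq0; move: wm; rewrite E mxE => ->.
Qed.

End SphereConnected.

(** The total weight on the component of [u] is 0 or 1 at every point, because supports are faces
    and so lie in one component. *)
Lemma skeleton_connected (R : realType) (n : nat) (V : finType) (K : {set {set V}}) (u w : V) :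
  sphere_triangulation R n K -> (0 < n)%N -> connect (one_skeleton K) u w.
Proof.
move=> Ktri n0; have [[_ K1 _] [f [g [fc gc fK gK]]]] := Ktri.
pose m (x : set_type (realization R K)) : R :=
  \sum_(v | connect (one_skeleton K) u v) (set_val x : {ptws V -> R}) v.
have mc : continuous m.
  apply: cts_sum => v.
  exact: (cts_comp (@set_val_cts _ (realization R K)) (@proj_continuous V (fun _ => R) v)).
have m01 x : m x = 0 \/ m x = 1.
  have [x0 x1 xK] : realization R K (set_val x) := set_valP x.
  set y := set_val x in x0 x1 xK.
  have [h|] := boolP [exists v, connect (one_skeleton K) u v && (y v != 0)]; last first.
    rewrite negb_exists => /forallP h; left; apply: big1 => v uv.
    by apply/eqP; have := h v; rewrite uv /= negbK.
  have /existsP[v /andP[uv yv]] := h; right.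
  rewrite -x1 /m [RHS](bigID (connect (one_skeleton K) u)) /= [X in _ = _ + X]big1 ?addr0 // => z uz.
  apply/eqP; apply: contraNT uz => yz; apply: connect_trans uv _.
  have [->|vz] := eqVneq v z; first exact: connect0.
  apply: connect1; rewrite /one_skeleton vz /=.
  apply: (face_sub Ktri xK); last by apply/set0Pn; exists v; rewrite !inE eqxx.
  by apply/fintype.subsetP => a; rewrite !inE => /orP[/eqP->|/eqP->].
have vtx v : exists x : set_type (realization R K), forall z, (set_val x : {ptws V -> R}) z = (z == v)%:R.
  have := barycenter_realization Ktri (K1 v) => /mem_set bP.
  exists (exist (fun x => x \in realization R K) _ bP) => z.
  by rewrite set_valE /= /barycenter cards1 divr1 finset.in_set1.
have [xu xuE] := vtx u; have [xw xwE] := vtx w.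
have hc : continuous (fun s => m (g s)) by exact: cts_comp gc mc.
have := two_valued_constant n0 hc (fun s => m01 (g s)) (f xu) (f xw).
rewrite !fK /m (bigD1 u) ?connect0 //= big1 ?addr0 => [|z /andP[_ /negPf zu]]; last first.
  by rewrite xuE zu.
rewrite xuE eqxx => muw; apply/negPn/negP => uw.
move: muw; rewrite big1 => [/eqP|z uz]; first by rewrite oner_eq0.
by rewrite xwE; case: eqP => // zw; rewrite -zw uz in uw.
Qed.

Close Scope ring_scope.
Close Scope classical_set_scope.

Theorem mainTheorem3 (R : realType) (k : nat) (hk : (4 <= k)%N) :
  exists C : nat,
    forall (V : finType) (K : {set {set V}}),
      sphere_triangulation R (k - 2) K ->
      colorable (one_skeleton K) (k - 1) ->
      forall alpha beta : {ffun V -> 'I_k},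
        coloring (one_skeleton K) alpha ->
        coloring (one_skeleton K) beta ->
        (exists gamma : {ffun V -> 'I_k},
          [/\ coloring (one_skeleton K) gamma, (num_colors gamma <= k - 1)%N
            & single_equivalent (one_skeleton K) alpha gamma]) ->
        (exists delta : {ffun V -> 'I_k},
          [/\ coloring (one_skeleton K) delta, (num_colors delta <= k - 1)%N
            & single_equivalent (one_skeleton K) beta delta]) ->
        exists s : seq {ffun V -> 'I_k},
          [/\ path (single_change (one_skeleton K)) alpha s,
              last alpha s = beta
            & (size s <= C * #|V| ^ (2 * ((k - 1) %/ 2)))%N].
Proof.
case: k hk => [|[|[|[|k]]]] // _.
have -> : k.+4 - 1 = k.+3 by rewrite subn1.
have -> : k.+4 - 2 = k.+2 by rewrite subn2.
(* The constant depends on the number of colors only: two descents to base colorings and a walk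
   through the permutations. *)
exists (2 + #|{perm 'I_k.+4}|) => V K Ktri [f f_col] alpha beta _ _ alpha_few beta_few.
have [V0|V_gt0] := posnP #|V|.
  exists [::]; split=> //; apply/ffunP => v.
  by have := fintype0 v V0.
have [[K0 K_vertex K_sub] _] := Ktri.
have K_pure s : s \in K -> #|s| < k.+3 -> exists2 v, v \notin s & (v |: s)%SET \in K.
  exact: face_extends Ktri _.
have K_link s u w : (s == finset.set0) || (s \in K) -> #|s|.+1 < k.+3 ->
    u \notin s -> w \notin s -> (u |: s)%SET \in K -> (w |: s)%SET \in K ->
    connect (link_rel K s) u w.
  case/orP => [/eqP -> _ _ _ _ _|sK sn us ws usK wsK]; last first.
    exact: (link_connected Ktri sK sn us ws usK wsK).
  have := skeleton_connected u w Ktri isT; apply: connect_sub => {}u {}w /andP[_ uwK].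
  by apply: connect1; rewrite /link_rel !inE finset.setU0.
have /card_gt0P[v _] := V_gt0.
have [F FF _] := vertex_in_facet K_vertex K_sub f_col K_pure v.
have [s [sp sl ss]] := reach_colorings K_vertex K_sub f_col K_pure K_link
  (ex_intro _ F FF) alpha_few beta_few.
(* The exponent is at least 2, as there are at least 4 colors. *)
exists s; split=> //; apply: leq_trans ss _; rewrite leq_mul2l leq_pexp2l ?orbT //.
by rewrite leq_pmulr // divn_gt0.
Qed.
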